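(* Let $(\mathcal{P},\mathcal{G},X,\pi)$ be a principal sheaf over the algebraized space $(X,\mathcal{A})$, let $\varphi:\mathcal{G}\to\mathcal{GL}(n,\mathcal{A})$ be a representation (a continuous morphism of sheaves of groups over $X$), and let $\mathcal{E}\equiv(\mathcal{E},X,p)$ be the sheaf associated with $\mathcal{P}$ by $\varphi$. Then $\mathcal{E}$ is a vector sheaf of rank $n$; that is, the operations on $\mathcal{E}$ obtained locally by transport along the isomorphisms $\psi_\alpha$ (as specified in the context) are well defined and make $\mathcal{E}$ a locally free $\mathcal{A}$-module of rank $n$.
   Context: $X$ is a topological space and $\mathcal{A}$ is a sheaf over $X$ of unital, commutative, associative $\mathbb{K}$-algebras ($\mathbb{K}=\mathbb{R}$ or $\mathbb{C}$); $(X,\mathcal{A})$ is called an algebraized space. $\mathcal{GL}(n,\mathcal{A})$ is the sheaf of groups generated by the complete presheaf $U\mapsto GL(n,\mathcal{A}(U))$; its sections over $U$ are identified with invertible $n\times n$ matrices over $\mathcal{A}(U)$, equivalently with $\mathcal{A}|_U$-linear automorphisms of $\mathcal{A}^n|_U$, and it acts on the left of $\mathcal{A}^n$. A principal sheaf $\mathcal{P}\equiv(\mathcal{P},\mathcal{G},X,\pi)$ consists of a sheaf of sets $\mathcal{P}$ over $X$ with projection $\pi$, a sheaf of groups $\mathcal{G}$ over $X$, a right action $\mathcal{P}\times_X\mathcal{G}\to\mathcal{P}$, and an open covering $\mathcal{U}=\{U_\alpha\mid\alpha\in I\}$ of $X$ together with $\mathcal{G}$-equivariant isomorphisms $\phi_\alpha:\mathcal{P}|_{U_\alpha}\to\mathcal{G}|_{U_\alpha}$.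 The natural sections are $s_\alpha:=\phi_\alpha^{-1}\circ\mathbf{1}|_{U_\alpha}\in\mathcal{P}(U_\alpha)$, where $\mathbf 1$ is the unit section of $\mathcal{G}$. Associated sheaf: for each open $U\subseteq X$ let $Q(U)$ be the quotient of $\mathcal{P}(U)\times\mathcal{A}^n(U)$ by the equivalence relation $(s,a)\sim(t,b)\iff\exists!\,g\in\mathcal{G}(U)$ with $t=s\cdot g$ and $b=\varphi(g^{-1})\cdot a$. The sheaf generated by the presheaf $U\mapsto Q(U)$ is $\mathcal{E}=\mathcal{P}\times_X\mathcal{A}^n/\mathcal{G}$, with obvious projection $p$, and is called the sheaf associated with $\mathcal{P}$ by $\varphi$. For each $\alpha$, let $\psi_\alpha:\mathcal{A}^n|_{U_\alpha}\to\mathcal{E}|_{U_\alpha}$ be the isomorphism of sheaves of sets generated by the maps $\mathcal{A}^n(V)\ni f\mapsto[s_\alpha|_V,f]\in Q(V)$, $V\subseteq U_\alpha$ open. Over $x\in U_\alpha$ the operations on $\mathcal{E}$ are $u+v:=\psi_\alpha(\psi_\alpha^{-1}(u)+\psi_\alpha^{-1}(v))$ and $a\cdot u:=\psi_\alpha(a\cdot\psi_\alpha^{-1}(u))$ for $u,v\in\mathcal{E}_x$, $a\in\mathcal{A}_x$. A vector sheaf of rank $n$ is a locally free $\mathcal{A}$-module of rank $n$ over $X$, i.e. an $\mathcal{A}$-module locally isomorphic (as $\mathcal{A}$-module) to $\mathcal{A}^n$. *)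

(* Defs.v *)
From HB Require Import structures.
From mathcomp Require Import all_boot all_algebra generic_quotient complex.
From mathcomp Require Import all_classical reals topology.

Set Implicit Arguments.
Unset Strict Implicit.
Unset Printing Implicit Defensive.

Import GRing.Theory.
Local Open Scope quotient_scope.
Local Open Scope classical_set_scope.
Local Open Scope ring_scope.

Variant ground := RealGround | ComplexGround.

Definition ground_field (R : realType) (k : ground) : fieldType :=
  match k with RealGround => R | ComplexGround => R[i]%C end.

(* The library's comAlgType requires 1 != 0, which would exclude sheaves of
   algebras with zero stalks. *)
Record commutative_algebra (K : pzRingType) := CommutativeAlgebra {
  alg_ring :> comPzRingType;
  alg_scale : K -> alg_ring -> alg_ring;
  alg_scaleA : forall k l a, alg_scale k (alg_scale l a) = alg_scale (k * l) a;
  alg_scale1 : forall a, alg_scale 1 a = a;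
  alg_scaleDr : forall k a b,
    alg_scale k (a + b) = alg_scale k a + alg_scale k b;
  alg_scaleDl : forall k l a,
    alg_scale (k + l) a = alg_scale k a + alg_scale l a;
  alg_scaleMl : forall k a b, alg_scale k (a * b) = alg_scale k a * b }.

Record opens (X : topologicalType) := Opens {
  oset :> set X;
  osetP : open oset }.

Definition opensT (X : topologicalType) : opens X := Opens (@openT X).

Definition opensI (X : topologicalType) (U V : opens X) : opens X :=
  Opens (openI (osetP U) (osetP V)).

(* The disjoint union of the fibres.  It is kept as an alias so that no topology
   is inferred on it. *)
Definition tot (X : Type) (F : X -> Type) : Type := {x : X & F x}.

Section tot_choice.
Variables (X : Type) (F : X -> Type).
HB.instance Definition _ := gen_eqMixin (tot F).
HB.instance Definition _ := gen_choiceMixin (tot F).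
End tot_choice.

Definition point_of (X : Type) (F : X -> Type) (x : X) (u : F x) : tot F :=
  existT F x u.

(* A topological space with a map p to X is presented by its fibres p^-1(x) and
   by the topology of the total space, the disjoint union of the fibres. *)
Record space_over (X : topologicalType) := SpaceOver {
  fibre :> X -> Type;
  total_class : Topological.axioms_ (tot fibre) }.

Definition total (X : topologicalType) (S : space_over X) : topologicalType :=
  @Topological.Pack (tot S) (total_class S).

Definition proj (X : topologicalType) (S : space_over X) : total S -> X :=
  fun z => projT1 z.

Definition in_total (X : topologicalType) (S : space_over X) (x : X) (u : S x) :
  total S := point_of u.

Definition local_homeomorphism (T X : topologicalType) (f : T -> X) : Prop :=
  forall t : T, exists O : set T,
    [/\ open O, O t, open (f @` O) &
      exists g : X -> T, [/\ {in O, cancel f g},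
        {within O, continuous f} & {within f @` O, continuous g}]].

Record sheaf (X : topologicalType) := Sheaf {
  sheaf_space :> space_over X;
  sheaf_lhomeo : local_homeomorphism (@proj X sheaf_space) }.

Section morphisms.
Variable X : topologicalType.
Implicit Types S T W : space_over X.

Definition fibre_continuous S T (f : forall x, S x -> T x) : Prop :=
  continuous (fun z : total S => in_total (f (projT1 z) (projT2 z)) : total T).

Definition prod_map S T (z : tot (fun x => (S x * T x)%type)) :
    (total S * total T)%type :=
  (in_total (projT2 z).1, in_total (projT2 z).2).

(* the fibre product, with the topology induced from the product *)
Definition fibre_prod S T : space_over X :=
  @SpaceOver X (fun x => (S x * T x)%type)
    (Topological.class (initial_topology (@prod_map S T))).

Definition fibre_continuous2 S T W (f : forall x, S x -> T x -> W x) : Prop :=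
  @fibre_continuous (fibre_prod S T) W (fun x uv => f x uv.1 uv.2).

Definition section_continuous S (s : forall x, S x) : Prop :=
  continuous (fun x : X => in_total (s x) : total S).

Definition over S (U : set X) : set (total S) := @proj X S @^-1` U.
Arguments over : clear implicits.

(* continuity of a fibrewise map on p^-1(U) *)
Definition continuous_over S T (U : set X)
    (f : forall x, U x -> S x -> T x) : Prop :=
  continuous (fun z : over S U =>
    in_total (f (projT1 (val z)) (set_valP z) (projT2 (val z))) : total T).

(* isomorphism over U of the restrictions of S and T to U *)
Record iso_over S T (U : set X) := IsoOver {
  iso_fun :> forall x, U x -> S x -> T x;
  iso_inv : forall x, U x -> T x -> S x;
  iso_funK : forall x (Ux : U x), cancel (iso_fun Ux) (iso_inv Ux);
  iso_invK : forall x (Ux : U x), cancel (iso_inv Ux) (iso_fun Ux);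
  iso_fun_continuous : continuous_over iso_fun;
  iso_inv_continuous : continuous_over iso_inv }.

Record section S (U : set X) := Section {
  sec_val :> forall x, U x -> S x;
  sec_continuous : continuous
    (fun z : U => in_total (sec_val (set_valP z)) : total S) }.

End morphisms.
Arguments over {X} S U.
Arguments iso_inv {X S T U} _ {x}.
Arguments iso_fun {X S T U} _ {x}.
Arguments sec_val {X S U} _ {x}.

Section sections.
Variable X : topologicalType.
Implicit Types (S T : space_over X) (U V : set X).

Lemma sectionP S U (s t : section S U) :
  (forall x (Ux : U x), sec_val s Ux = sec_val t Ux) -> s = t.
Proof.
case: s t => [s cs] [t ct] /= st.
have E : s = t by apply: functional_extensionality_dep => x; apply: functional_extensionality_dep.
by case: _ / E ct => ct; congr Section; exact: Prop_irrelevance.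
Qed.

Lemma sec_val_irr S U (s : section S U) x (h h' : U x) :
  sec_val s h = sec_val s h'.
Proof. by congr sec_val; exact: Prop_irrelevance. Qed.

Definition set_incl U V (VU : V `<=` U) (z : V) : U :=
  exist _ (val z) (mem_set (VU _ (set_valP z))).

Lemma set_incl_continuous U V (VU : V `<=` U) : continuous (set_incl VU).
Proof.
apply: continuous_comp_initial.
by have := @initial_continuous _ _ (@set_val X V).
Qed.

Lemma sec_res_continuous S U V (VU : V `<=` U) (s : section S U) :
  continuous (fun z : V => in_total (sec_val s (VU _ (set_valP z))) : total S).
Proof.
move=> z; have := @continuous_comp _ _ _ (set_incl VU) _ z
  (@set_incl_continuous U V VU z) (@sec_continuous _ _ _ s (set_incl VU z)).
rewrite /comp /=; congr (continuous_at _ _); apply: funext => y.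
by congr in_total; apply: sec_val_irr.
Qed.

Definition sec_res S U V (VU : V `<=` U) (s : section S U) : section S V :=
  @Section X S V (fun x Vx => sec_val s (VU x Vx)) (@sec_res_continuous S U V VU s).

Lemma section_op_continuous S T (W : space_over X) (f : forall x, S x -> T x -> W x) (U : set X)
    (s : section S U) (t : section T U) : fibre_continuous2 f ->
  continuous (fun z : U =>
    in_total (f _ (sec_val s (set_valP z)) (sec_val t (set_valP z))) : total W).
Proof.
move=> cf z.
pose st (z : U) : total (fibre_prod S T) :=
  @in_total X (fibre_prod S T) _ (sec_val s (set_valP z), sec_val t (set_valP z)).
have cst : continuous st.
  apply: (@continuous_comp_initial _ _ _ (@prod_map X S T) st) => y.
  by apply: cvg_pair; [exact: nbhs_filter|exact: (@sec_continuous _ _ _ s y)|exact: (@sec_continuous _ _ _ t y)].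
exact: (@continuous_comp _ _ _ st _ z (cst z) (cf (st z))).
Qed.

Lemma section_op1_continuous S T (f : forall x, S x -> T x) (U : set X)
    (s : section S U) : fibre_continuous f ->
  continuous (fun z : U =>
    in_total (f _ (sec_val s (set_valP z))) : total T).
Proof.
move=> cf z.
exact: (@continuous_comp _ _ _ _ _ z (@sec_continuous _ _ _ s z) (cf _)).
Qed.

Lemma section_const_continuous S (s : forall x, S x) (U : set X) :
  section_continuous s ->
  continuous (fun z : U => in_total (s (val z)) : total S).
Proof.
move=> cs z.
exact: (@continuous_comp _ _ _ _ _ z (@initial_continuous _ _ (@set_val X U) z) (cs _)).
Qed.

End sections.

Record presheaf (X : topologicalType) := Presheaf {
  psec :> opens X -> Type;
  pres : forall U V : opens X, V `<=` U -> psec U -> psec V;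
  pres_id : forall (U : opens X) (UU : U `<=` U) s, pres UU s = s;
  pres_comp : forall (U V W : opens X) (VU : V `<=` U) (WV : W `<=` V)
    (WU : W `<=` U) s, pres WV (pres VU s) = pres WU s }.

Section germs.
Variables (X : topologicalType) (F : presheaf X).

Record germ_rep (x : X) := GermRep {
  gr_dom : opens X;
  gr_mem : oset gr_dom x;
  gr_sec : F gr_dom }.

Definition germ_rel x (r r' : {classic germ_rep x}) : bool :=
  `[< exists (W : opens X) (h : W `<=` gr_dom r) (h' : W `<=` gr_dom r'),
        oset W x /\ pres h (gr_sec r) = pres h' (gr_sec r') >].

Lemma germ_relP x : equiv_class_of (@germ_rel x).
Proof.
split.
- by move=> r; apply/asboolP; exists (gr_dom r), (fun _ => id), (fun _ => id); split => //; exact: gr_mem.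
- suff h r r' : @germ_rel x r r' -> germ_rel r' r by move=> r r'; apply/idP/idP; exact: h.
  by move/asboolP => [W [h [h' [Wx E]]]]; apply/asboolP; exists W, h', h.
- move=> r2 r1 r3 /asboolP [W [h1 [h2 [Wx E]]]] /asboolP [V [k2 [k3 [Vx E']]]].
  apply/asboolP; exists (opensI W V).
  have WVW : opensI W V `<=` W by move=> y [].
  have WVV : opensI W V `<=` V by move=> y [].
  exists (subset_trans WVW h1), (subset_trans WVV k3); split => //.
  rewrite -(pres_comp h1 WVW) E -(pres_comp k3 WVV) -E'.
  by rewrite (pres_comp h2 WVW (subset_trans WVW h2)) (pres_comp k2 WVV (subset_trans WVW h2)).
Qed.

Canonical germ_equiv x := EquivRelPack (@germ_relP x).

(* the stalk at x of the sheaf generated by F *)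
Definition germ (x : X) : Type := {eq_quot (@germ_equiv x)}.

Definition germ_at (U : opens X) (s : F U) (x : X) (Ux : oset U x) : germ x :=
  \pi_({eq_quot (@germ_equiv x)}) (GermRep Ux s).

Lemma germ_atP x (e : germ x) :
  exists (U : opens X) (s : F U) (Ux : oset U x), e = germ_at s Ux.
Proof.
have := @reprK _ {eq_quot (@germ_equiv x)} e.
by case: (repr _) => U Ux s <-; exists U, s, Ux.
Qed.

Lemma germ_at_eq (U V : opens X) (s : F U) (t : F V) x (Ux : oset U x)
    (Vx : oset V x) : germ_at s Ux = germ_at t Vx <->
  exists (W : opens X) (WU : W `<=` U) (WV : W `<=` V),
    oset W x /\ pres WU s = pres WV t.
Proof.
split => [/eqquotP/asboolP[W [h [h' [Wx E]]]]|[W [h [h' [Wx E]]]]].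
  by exists W, h, h'.
by apply/eqquotP/asboolP; exists W, h, h'.
Qed.

Lemma germ_at_res (U V : opens X) (VU : V `<=` U) (s : F U) x (Vx : oset V x)
  (Ux : oset U x) : germ_at (pres VU s) Vx = germ_at s Ux.
Proof.
apply/germ_at_eq; exists V, (fun _ => id), VU; split => //.
by rewrite pres_id.
Qed.

Lemma germ_at_irr (U : opens X) (s : F U) x (Ux Ux' : oset U x) :
  germ_at s Ux = germ_at s Ux'.
Proof. by congr germ_at; exact: Prop_irrelevance. Qed.

(* the set of germs of a section of F over U *)
Definition germ_image (U : opens X) (s : F U) : set (tot germ) :=
  [set z | exists (x : X) (Ux : oset U x), z = point_of (germ_at s Ux)].

Definition germ_base : set (set (tot germ)) :=
  [set O | exists (U : opens X) (s : F U), O = germ_image s].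

Definition germ_space : Type := tot germ.

HB.instance Definition _ := Choice.on germ_space.

Lemma germ_base_cover : \bigcup_(O in germ_base) O = [set: germ_space].
Proof.
apply/seteqP; split => // -[x e] _.
have [U [s [Ux ->]]] := germ_atP e.
by exists (germ_image s); [exists U, s|exists x, Ux].
Qed.

Lemma germ_imageE (U : opens X) (s : F U) x (e : germ x) :
  germ_image s (point_of e) <-> exists Ux : oset U x, e = germ_at s Ux.
Proof.
split=> [[y [Uy E]]|[Ux ->]]; last by exists x, Ux.
have xy := existT_inj1 E; subst y.
by exists Uy; exact: (existT_inj2 E).
Qed.

Lemma germ_base_join (O O' : set (tot germ)) (z : germ_space) :
  germ_base O -> germ_base O' -> O z -> O' z ->
  exists O'', [/\ germ_base O'', O'' z & O'' `<=` O `&` O'].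
Proof.
move=> [U [s ->]] [V [t ->]]; case: z => x e /germ_imageE [Ux ->] /germ_imageE [Vx].
move/germ_at_eq => [W [WU [WV [Wx E]]]].
exists (germ_image (pres WU s)); split.
- by exists W, (pres WU s).
- by apply/germ_imageE; exists Wx; rewrite (germ_at_res _ _ _ Ux).
- move=> _ [y [Wy ->]]; split; apply/germ_imageE.
    by exists (WU _ Wy); exact: germ_at_res.
  by exists (WV _ Wy); rewrite E; exact: germ_at_res.
Qed.

HB.instance Definition _ := isBaseTopological.Build germ_space
  germ_base_cover germ_base_join.

Definition generated_space : space_over X :=
  @SpaceOver X germ (Topological.class germ_space).

Lemma germ_openP (O : set (total generated_space)) : open O <->
  forall x (e : germ x), O (point_of e) -> exists (U : opens X) (s : F U)
    (Ux : oset U x), e = germ_at s Ux /\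
    forall y (Uy : oset U y), O (point_of (germ_at s Uy)).
Proof.
rewrite openE; split.
- move=> oO x e Oe; have [B [/= [D' D'b <-] [C D'C Ce] BO]] := oO _ Oe.
  have [U [s sC]] := D'b _ D'C; rewrite sC in Ce.
  have /germ_imageE [Ux eE] := Ce; exists U, s, Ux; split => // y Uy.
  by apply: BO; exists C => //; rewrite sC; apply/germ_imageE; exists Uy.
- move=> h [x e] Oe; have [U [s [Ux [eE sO]]]] := h x e Oe.
  exists (germ_image s); split.
  + exists [set germ_image s]; first by move=> _ ->; exists U, s.
    by rewrite bigcup_set1.
  + by apply/germ_imageE; exists Ux.
  + by move=> _ [y [Uy ->]]; exact: sO.
Qed.

Lemma germ_image_open (U : opens X) (s : F U) :
  open (germ_image s : set (total generated_space)).
Proof.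
apply/germ_openP => x e /germ_imageE [Ux ->]; exists U, s, Ux; split => // y Uy.
by apply/germ_imageE; exists Uy.
Qed.

Lemma generated_lhomeo : local_homeomorphism (@proj X generated_space).
Proof.
move=> [x e]; have [U [s [Ux eE]]] := germ_atP e.
pose sect (y : X) : total generated_space :=
  if pselect (oset U y) is left Uy then point_of (germ_at s Uy)
  else point_of e.
have sectE y (Uy : oset U y) : sect y = point_of (germ_at s Uy).
  by rewrite /sect; case: pselect => // Uy'; rewrite (germ_at_irr s Uy' Uy).
have imE : (@proj X generated_space) @` (germ_image s) = oset U.
  apply/seteqP; split => [_ [_ [y [Uy ->]] <-] //|y Uy].
  by exists (point_of (germ_at s Uy)) => //; exists y, Uy.
exists (germ_image s); split.
- exact: germ_image_open.
- by apply/germ_imageE; exists Ux.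
- by rewrite imE; exact: osetP.
exists sect; split.
- by move=> z /set_mem [y [Uy ->]]; exact: sectE.
- apply: continuous_subspaceT; apply/continuousP => V oV; apply/germ_openP.
  move=> y f Vy; have [W [t [Wy fE]]] := germ_atP f.
  pose V' := Opens oV; have WVW : opensI W V' `<=` W by move=> ? [].
  have Wy' : oset (opensI W V') y by [].
  exists (opensI W V'), (pres WVW t), Wy'; split; last by move=> ? [].
  by rewrite (germ_at_res _ _ _ Wy).
- rewrite imE; apply: (@continuous_in_subspaceT _ _ _ _) => y /set_mem Uy.
  move=> O; rewrite nbhsE => -[B [oB By] BO].
  have : B (point_of (germ_at s Uy)) by rewrite -sectE.
  move: oB => /germ_openP h /h [W [t [Wy [/germ_at_eq [V [VU [VW [Vy E]]]] tB]]]].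
  rewrite /= nbhs_filterE nbhsE; exists V; first by split => //; exact: osetP.
  move=> w Vw; apply: BO; rewrite (sectE _ (VU _ Vw)).
  by rewrite -(germ_at_res VU s Vw) E (germ_at_res VW t Vw (VW _ Vw)); exact: tB.
Qed.

Definition generated_sheaf : sheaf X := Sheaf generated_lhomeo.

End germs.

Record group_sheaf (X : topologicalType) := GroupSheaf {
  group_stalk : X -> groupType;
  group_total_class : Topological.axioms_ (tot group_stalk);
  group_space := SpaceOver group_total_class;
  group_lhomeo : local_homeomorphism (@proj X group_space);
  group_one_continuous :
    @section_continuous X group_space (fun x => 1%g : group_stalk x);
  group_mul_continuous : @fibre_continuous2 X group_space group_space group_space
    (fun x (u v : group_stalk x) => (u * v)%g);
  group_inv_continuous : @fibre_continuous X group_space group_space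
    (fun x (u : group_stalk x) => (u^-1)%g) }.

Coercion group_underlying (X : topologicalType) (G : group_sheaf X) : sheaf X :=
  Sheaf (@group_lhomeo X G).

Section group_sections.
Variables (X : topologicalType) (G : group_sheaf X) (U : set X).
Implicit Types g h : section G U.

Definition sec_one : section G U :=
  @Section X G U (fun x _ => 1%g : group_stalk G x)
    (@section_const_continuous X G _ U (@group_one_continuous X G)).

Definition sec_mul g h : section G U :=
  @Section X G U
    (fun x Ux => (sec_val g Ux * sec_val h Ux : group_stalk G x)%g)
    (@section_op_continuous X G G G _ U g h (@group_mul_continuous X G)).

Definition sec_inv g : section G U :=
  @Section X G U (fun x Ux => ((sec_val g Ux : group_stalk G x)^-1)%g)
    (@section_op1_continuous X G G _ U g (@group_inv_continuous X G)).

End group_sections.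

Record group_presheaf (X : topologicalType) := GroupPresheaf {
  gpsec : opens X -> groupType;
  gpres : forall U V : opens X, V `<=` U -> gpsec U -> gpsec V;
  gpres_id : forall (U : opens X) (UU : U `<=` U) s, gpres UU s = s;
  gpres_comp : forall (U V W : opens X) (VU : V `<=` U) (WV : W `<=` V)
    (WU : W `<=` U) s, gpres WV (gpres VU s) = gpres WU s;
  gpresM : forall (U V : opens X) (VU : V `<=` U) s t,
    gpres VU (s * t)%g = (gpres VU s * gpres VU t)%g }.

Coercion group_presheaf_underlying (X : topologicalType)
    (F : group_presheaf X) : presheaf X :=
  Presheaf (@gpres_id X F) (@gpres_comp X F).

Section group_germs.
Variables (X : topologicalType) (F : group_presheaf X).

Lemma gpres1 (U V : opens X) (VU : V `<=` U) : @gpres X F U V VU 1%g = 1%g.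
Proof.
by apply: (mulgI (gpres VU 1%g)); rewrite -gpresM !mulg1.
Qed.

Lemma gpresV (U V : opens X) (VU : V `<=` U) (s : gpsec F U) :
  gpres VU (s^-1)%g = ((gpres VU s)^-1)%g.
Proof.
by apply: (mulgI (gpres VU s)); rewrite -gpresM !mulgV gpres1.
Qed.

Variable x : X.
Local Notation germ := (germ F x).
Implicit Types e f : germ.

Definition germ_one : germ :=
  @germ_at X F (opensT X) (1%g : gpsec F (opensT X)) x I.

Definition germ_inv e : germ :=
  let r := repr e in germ_at ((gr_sec r : gpsec F (gr_dom r))^-1%g : F _) (gr_mem r).

Lemma subIl (U V : opens X) : opensI U V `<=` U. Proof. by move=> ? []. Qed.
Lemma subIr (U V : opens X) : opensI U V `<=` V. Proof. by move=> ? []. Qed.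

Definition germ_mul e f : germ :=
  let r := repr e in let t := repr f in
  @germ_at X F (opensI (gr_dom r) (gr_dom t))
    (gpres (@subIl _ _) (gr_sec r) * gpres (@subIr _ _) (gr_sec t))%g
    x (conj (gr_mem r) (gr_mem t)).

Lemma germ_reprE e : germ_at (gr_sec (repr e)) (gr_mem (repr e)) = e.
Proof.
by rewrite -[RHS](@reprK _ {eq_quot (@germ_equiv X F x)}); case: (repr e).
Qed.

Lemma germ_at_mul (U : opens X) (s t : gpsec F U) (Ux : oset U x) :
  germ_mul (@germ_at X F U s x Ux) (@germ_at X F U t x Ux) =
  @germ_at X F U (s * t)%g x Ux.
Proof.
rewrite /germ_mul.
have := germ_reprE (@germ_at X F U s x Ux).
have := germ_reprE (@germ_at X F U t x Ux).
case: (repr (@germ_at X F U s x Ux)) => /= V Vx v.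
case: (repr (@germ_at X F U t x Ux)) => /= W Wx w.
move=> /germ_at_eq [T [TW [TU [Tx E]]]] /germ_at_eq [S [SV [SU [Sx E']]]].
apply/germ_at_eq; pose O := opensI S T.
have OS : O `<=` S by exact: subIl.
have OT : O `<=` T by exact: subIr.
have OVW : O `<=` opensI V W.
  by move=> y [Sy Ty]; split; [exact: (SV y)|exact: (TW y)].
have OU : O `<=` U by exact: (subset_trans OS SU).
exists O, OVW, OU; split; first by split.
rewrite /= !gpresM (gpres_comp _ OVW (subset_trans OS SV)).
rewrite (gpres_comp _ OVW (subset_trans OT TW)).
rewrite /= in E E'.
by rewrite -(gpres_comp SV OS) E' -(gpres_comp TW OT) E !(gpres_comp _ _ OU).
Qed.

Lemma germ_at_inv (U : opens X) (s : gpsec F U) (Ux : oset U x) :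
  germ_inv (@germ_at X F U s x Ux) = @germ_at X F U (s^-1)%g x Ux.
Proof.
rewrite /germ_inv.
have := germ_reprE (@germ_at X F U s x Ux).
case: (repr (@germ_at X F U s x Ux)) => /= V Vx v.
move=> /germ_at_eq [S [SV [SU [Sx E]]]].
apply/germ_at_eq; exists S, SV, SU; split => //.
by rewrite /= !gpresV; congr (_^-1)%g.
Qed.

Lemma germ_at_one (U : opens X) (Ux : oset U x) :
  germ_one = @germ_at X F U (1%g : gpsec F U) x Ux.
Proof.
apply/germ_at_eq; exists U, (fun _ _ => I), (fun _ => id); split => //.
by rewrite /= !gpres1.
Qed.

Lemma germ_at2 e f : exists (U : opens X) (Ux : oset U x) (s t : gpsec F U),
  e = @germ_at X F U s x Ux /\ f = @germ_at X F U t x Ux.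
Proof.
have [U [s [Ux ->]]] := germ_atP e; have [V [t [Vx ->]]] := germ_atP f.
exists (opensI U V), (conj Ux Vx), (gpres (@subIl U V) s), (gpres (@subIr U V) t).
by split; [rewrite (@germ_at_res X F _ _ (@subIl U V) s x _ Ux)
          |rewrite (@germ_at_res X F _ _ (@subIr U V) t x _ Vx)].
Qed.

Lemma germ_mul1 : left_id germ_one germ_mul.
Proof.
move=> e; have [U [s [Ux ->]]] := germ_atP e.
by rewrite (germ_at_one Ux) germ_at_mul mul1g.
Qed.

Lemma germ_mulr1 : right_id germ_one germ_mul.
Proof.
move=> e; have [U [s [Ux ->]]] := germ_atP e.
by rewrite (germ_at_one Ux) germ_at_mul mulg1.
Qed.

Lemma germ_mulV : left_inverse germ_one germ_inv germ_mul.
Proof.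
move=> e; have [U [s [Ux ->]]] := germ_atP e.
by rewrite germ_at_inv germ_at_mul mulVg (germ_at_one Ux).
Qed.

Lemma germ_mulrV : right_inverse germ_one germ_inv germ_mul.
Proof.
move=> e; have [U [s [Ux ->]]] := germ_atP e.
by rewrite germ_at_inv germ_at_mul mulgV (germ_at_one Ux).
Qed.

Lemma germ_mulA : associative germ_mul.
Proof.
move=> e f g; have [U [Ux [s [t [-> ->]]]]] := germ_at2 e f.
have [V [r [Vx ->]]] := germ_atP g.
pose W := opensI U V; have Wx : oset W x by split.
rewrite -(@germ_at_res X F _ _ (@subIl U V) s x Wx Ux).
rewrite -(@germ_at_res X F _ _ (@subIl U V) t x Wx Ux).
rewrite -(@germ_at_res X F _ _ (@subIr U V) r x Wx Vx).
by rewrite !germ_at_mul mulgA.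
Qed.

Definition group_germ : Type := germ.
HB.instance Definition _ := gen_eqMixin group_germ.
HB.instance Definition _ := gen_choiceMixin group_germ.
HB.instance Definition _ := isGroup.Build group_germ
  germ_mulA germ_mul1 germ_mulr1 germ_mulV germ_mulrV.

End group_germs.

Section generated_group_sheaf.
Variables (X : topologicalType) (F : group_presheaf X).

Let GF (x : X) : groupType := group_germ F x.

Lemma generated_one_continuous :
  @section_continuous X (generated_space F) (fun x => 1%g : GF x).
Proof.
apply/continuousP => O /germ_openP oO; rewrite openE => x Ox.
have [U [s [Ux [xE sO]]]] := oO _ _ Ox.
have [W [WU [WT [Wx E]]]] := (@germ_at_eq X F _ _ _ _ _ _ _).1 xE.
rewrite /interior nbhsE; exists W; first by split => //; exact: osetP.
move=> y Wy; rewrite /preimage /=.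
have -> : (1%g : GF y) = germ_at s (WT y Wy).
  rewrite -(@germ_at_res X F _ _ WT s y Wy (WT y Wy)) -E.
  by rewrite (@germ_at_res X F _ _ WU _ y Wy I).
exact: sO.
Qed.

Lemma generated_inv_continuous :
  @fibre_continuous X (generated_space F) (generated_space F)
    (fun x (u : GF x) => (u^-1)%g).
Proof.
apply/continuousP => O /germ_openP oO; apply/germ_openP => x e /= Oe.
have [V [t [Vx eE]]] := germ_atP e; subst e.
rewrite /preimage /= in Oe; have [U [s [Ux [xE sO]]]] := oO _ _ Oe.
rewrite /in_total /inv /= in xE.
have {}xE : @germ_at X F V (t^-1)%g x Vx = germ_at s Ux.
  by rewrite -xE; exact/esym/germ_at_inv.
have [W [WV [WU [Wx E]]]] := (@germ_at_eq X F _ _ _ _ _ _ _).1 xE.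
exists W, (gpres WV t), Wx; split.
  by rewrite (@germ_at_res X F _ _ WV t x Wx Vx).
move=> y Wy; rewrite /preimage /=.
have -> : ((@germ_at X F W (gpres WV t) y Wy : GF y)^-1)%g = germ_at s (WU y Wy).
  transitivity (@germ_at X F W ((gpres WV t)^-1)%g y Wy); first exact: germ_at_inv.
  by rewrite -gpresV -(@germ_at_res X F _ _ WU s y Wy (WU y Wy)) -E.
exact: sO.
Qed.

Lemma generated_mul_continuous :
  @fibre_continuous2 X (generated_space F) (generated_space F)
    (generated_space F) (fun x (u v : GF x) => (u * v)%g).
Proof.
apply/continuousP => O /germ_openP oO; rewrite openE => -[x [e f]] /= Oef.
have [V [Vx [t [r [eE fE]]]]] := germ_at2 e f; subst e f.
rewrite /preimage /= in Oef; have [U [s [Ux [xE sO]]]] := oO _ _ Oef.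
have {}xE : @germ_at X F V (t * r)%g x Vx = germ_at s Ux.
  by rewrite -xE; exact/esym/germ_at_mul.
have [W [WV [WU [Wx E]]]] := (@germ_at_eq X F _ _ _ _ _ _ _).1 xE.
rewrite /interior nbhsE.
pose D : set (total (generated_space F) * total (generated_space F)) :=
  @germ_image X F W (gpres WV t) `*` @germ_image X F W (gpres WV r).
exists ((@prod_map X (generated_space F) (generated_space F)) @^-1` D).
  split.
    exists D => //; rewrite openE => -[a b] [/= Da Db].
    exists (@germ_image X F W (gpres WV t), @germ_image X F W (gpres WV r)) => //.
    by split; apply: open_nbhs_nbhs; split => //; exact: germ_image_open.
  by split; apply/germ_imageE; exists Wx; rewrite (@germ_at_res X F _ _ WV _ x Wx Vx).
move=> [y [a b]] [/germ_imageE [Wy /= ->] /germ_imageE [Wy' /= ->]].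
rewrite (germ_at_irr _ Wy' Wy) /preimage /=.
set ab := (_ * _)%g.
have -> : ab = germ_at s (WU y Wy).
  transitivity (@germ_at X F W (gpres WV t * gpres WV r)%g y Wy).
    exact: germ_at_mul.
  by rewrite -gpresM -(@germ_at_res X F _ _ WU s y Wy (WU y Wy)) -E.
exact: sO.
Qed.

Definition generated_group_sheaf : group_sheaf X :=
  @GroupSheaf X GF (total_class (generated_space F)) (@generated_lhomeo X F)
    generated_one_continuous generated_mul_continuous generated_inv_continuous.

End generated_group_sheaf.

(* Scalar multiplication is continuous for the discrete topology on K. *)
Record algebra_sheaf (K : pzRingType) (X : topologicalType) := AlgebraSheaf {
  algebra_stalk : X -> commutative_algebra K;
  algebra_total_class : Topological.axioms_ (tot algebra_stalk);
  algebra_space := SpaceOver algebra_total_class;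
  algebra_lhomeo : local_homeomorphism (@proj X algebra_space);
  algebra_zero_continuous :
    @section_continuous X algebra_space (fun x => 0 : algebra_stalk x);
  algebra_one_continuous :
    @section_continuous X algebra_space (fun x => 1 : algebra_stalk x);
  algebra_opp_continuous : @fibre_continuous X algebra_space algebra_space
    (fun x (a : algebra_stalk x) => - a);
  algebra_add_continuous :
    @fibre_continuous2 X algebra_space algebra_space algebra_space
      (fun x (a b : algebra_stalk x) => a + b);
  algebra_mul_continuous :
    @fibre_continuous2 X algebra_space algebra_space algebra_space
      (fun x (a b : algebra_stalk x) => a * b);
  algebra_scale_continuous : forall k : K,
    @fibre_continuous X algebra_space algebra_space
      (fun x (a : algebra_stalk x) => alg_scale k a) }.

Coercion algebra_underlying (K : pzRingType) (X : topologicalType)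
  (A : algebra_sheaf K X) : sheaf X := Sheaf (@algebra_lhomeo K X A).

Section algebra_sections.
Variables (K : pzRingType) (X : topologicalType) (A : algebra_sheaf K X).

Definition algebra_section (U : set X) : Type := section A U.

Section ring.
Variable U : set X.
Local Notation AU := (algebra_section U).
Implicit Types s t : AU.

Definition asec_zero : AU :=
  @Section X A U (fun x _ => 0 : algebra_stalk A x)
    (@section_const_continuous X A _ U (@algebra_zero_continuous K X A)).
Definition asec_one : AU :=
  @Section X A U (fun x _ => 1 : algebra_stalk A x)
    (@section_const_continuous X A _ U (@algebra_one_continuous K X A)).
Definition asec_opp s : AU :=
  @Section X A U (fun x Ux => - (sec_val s Ux : algebra_stalk A x))
    (@section_op1_continuous X A A _ U s (@algebra_opp_continuous K X A)).
Definition asec_add s t : AU :=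
  @Section X A U (fun x Ux => (sec_val s Ux : algebra_stalk A x) + sec_val t Ux)
    (@section_op_continuous X A A A _ U s t (@algebra_add_continuous K X A)).
Definition asec_mul s t : AU :=
  @Section X A U (fun x Ux => (sec_val s Ux : algebra_stalk A x) * sec_val t Ux)
    (@section_op_continuous X A A A _ U s t (@algebra_mul_continuous K X A)).

Lemma asec_addA : associative asec_add.
Proof. by move=> r s t; apply: sectionP => x Ux /=; rewrite addrA. Qed.
Lemma asec_addC : commutative asec_add.
Proof. by move=> s t; apply: sectionP => x Ux /=; rewrite addrC. Qed.
Lemma asec_add0 : left_id asec_zero asec_add.
Proof. by move=> s; apply: sectionP => x Ux /=; rewrite add0r. Qed.
Lemma asec_addN : left_inverse asec_zero asec_opp asec_add.
Proof. by move=> s; apply: sectionP => x Ux /=; rewrite addNr. Qed.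
Lemma asec_mulA : associative asec_mul.
Proof. by move=> r s t; apply: sectionP => x Ux /=; rewrite mulrA. Qed.
Lemma asec_mulC : commutative asec_mul.
Proof. by move=> s t; apply: sectionP => x Ux /=; rewrite mulrC. Qed.
Lemma asec_mul1 : left_id asec_one asec_mul.
Proof. by move=> s; apply: sectionP => x Ux /=; rewrite mul1r. Qed.
Lemma asec_mulDl : left_distributive asec_mul asec_add.
Proof. by move=> r s t; apply: sectionP => x Ux /=; rewrite mulrDl. Qed.

HB.instance Definition _ := gen_eqMixin AU.
HB.instance Definition _ := gen_choiceMixin AU.
HB.instance Definition _ := GRing.isZmodule.Build AU
  asec_addA asec_addC asec_add0 asec_addN.
HB.instance Definition _ := GRing.Zmodule_isComPzRing.Build AU
  asec_mulA asec_mulC asec_mul1 asec_mulDl.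

Definition asec_eval (x : X) (Ux : U x) (s : AU) : algebra_stalk A x :=
  sec_val s Ux.

Lemma asec_eval_additive x (Ux : U x) : zmod_morphism (asec_eval Ux).
Proof. by []. Qed.
Lemma asec_eval_multiplicative x (Ux : U x) : monoid_morphism (asec_eval Ux).
Proof. by []. Qed.
HB.instance Definition _ x (Ux : U x) := GRing.isZmodMorphism.Build
  AU (algebra_stalk A x) (asec_eval Ux) (asec_eval_additive Ux).
HB.instance Definition _ x (Ux : U x) := GRing.isMonoidMorphism.Build
  AU (algebra_stalk A x) (asec_eval Ux) (asec_eval_multiplicative Ux).

End ring.

Definition asec_res (U V : set X) (VU : V `<=` U) (s : algebra_section U) :
  algebra_section V := sec_res VU s.

Lemma asec_res_additive U V (VU : V `<=` U) : zmod_morphism (asec_res VU).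
Proof. by move=> s t; apply: sectionP. Qed.
Lemma asec_res_multiplicative U V (VU : V `<=` U) : monoid_morphism (asec_res VU).
Proof. by split => [|s t]; apply: sectionP. Qed.
HB.instance Definition _ U V (VU : V `<=` U) := GRing.isZmodMorphism.Build
  (algebra_section U) (algebra_section V) (asec_res VU) (asec_res_additive VU).
HB.instance Definition _ U V (VU : V `<=` U) := GRing.isMonoidMorphism.Build
  (algebra_section U) (algebra_section V) (asec_res VU) (asec_res_multiplicative VU).

End algebra_sections.

(* GL(n, B) for a commutative ring B that may be zero, as A(U) is when U is
   empty; the library's unitmx does not cover this case. *)
Record general_linear (B : comPzRingType) (n : nat) := GeneralLinear {
  gl_mx :> 'M[B]_n;
  gl_invertible : exists N : 'M[B]_n, gl_mx *m N = 1%:M /\ N *m gl_mx = 1%:M }.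

Section general_linear_group.
Variables (B : comPzRingType) (n : nat).
Local Notation GL := (general_linear B n).
Implicit Types M N : GL.

Lemma gl_mx_inj M N : gl_mx M = gl_mx N -> M = N.
Proof.
case: M N => [M hM] [N hN] /= E; case: _ / E hN => hN.
by congr GeneralLinear; exact: Prop_irrelevance.
Qed.

Lemma gl_one_invertible :
  exists N : 'M[B]_n, 1%:M *m N = 1%:M /\ N *m 1%:M = 1%:M.
Proof. by exists 1%:M; rewrite mulmx1. Qed.
Definition gl_one : GL := GeneralLinear gl_one_invertible.

Lemma gl_mul_invertible M N : exists N' : 'M[B]_n,
  (M *m N) *m N' = 1%:M /\ N' *m (M *m N) = 1%:M.
Proof.
have [M' [MM' M'M]] := gl_invertible M; have [N' [NN' N'N]] := gl_invertible N.
exists (N' *m M'); split.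
  by rewrite mulmxA -(mulmxA _ (gl_mx N)) NN' mulmx1.
by rewrite mulmxA -(mulmxA N') M'M mulmx1.
Qed.
Definition gl_mul M N : GL := GeneralLinear (gl_mul_invertible M N).

Definition gl_inv_mx M : 'M[B]_n := projT1 (cid (gl_invertible M)).
Lemma gl_inv_mxP M : M *m gl_inv_mx M = 1%:M /\ gl_inv_mx M *m M = 1%:M.
Proof. exact: projT2 (cid (gl_invertible M)). Qed.
Lemma gl_inv_invertible M : exists N : 'M[B]_n,
  gl_inv_mx M *m N = 1%:M /\ N *m gl_inv_mx M = 1%:M.
Proof. by exists M; have [] := gl_inv_mxP M. Qed.
Definition gl_inv M : GL := GeneralLinear (gl_inv_invertible M).

Lemma gl_mulA : associative gl_mul.
Proof. by move=> L M N; apply: gl_mx_inj; exact: mulmxA. Qed.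
Lemma gl_mul1 : left_id gl_one gl_mul.
Proof. by move=> M; apply: gl_mx_inj; exact: mul1mx. Qed.
Lemma gl_mulr1 : right_id gl_one gl_mul.
Proof. by move=> M; apply: gl_mx_inj; exact: mulmx1. Qed.
Lemma gl_mulV : left_inverse gl_one gl_inv gl_mul.
Proof. by move=> M; apply: gl_mx_inj; have [] := gl_inv_mxP M. Qed.
Lemma gl_mulrV : right_inverse gl_one gl_inv gl_mul.
Proof. by move=> M; apply: gl_mx_inj; have [] := gl_inv_mxP M. Qed.

HB.instance Definition _ := gen_eqMixin GL.
HB.instance Definition _ := gen_choiceMixin GL.
HB.instance Definition _ := isGroup.Build GL
  gl_mulA gl_mul1 gl_mulr1 gl_mulV gl_mulrV.

End general_linear_group.

Section general_linear_sheaf.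
Variables (K : pzRingType) (X : topologicalType) (A : algebra_sheaf K X).
Variable n : nat.

Lemma gl_res_invertible (U V : opens X) (VU : V `<=` U)
    (M : general_linear (algebra_section A U) n) :
  exists N : 'M[algebra_section A V]_n,
    map_mx (asec_res VU) M *m N = 1%:M /\ N *m map_mx (asec_res VU) M = 1%:M.
Proof.
have [N [MN NM]] := gl_invertible M; exists (map_mx (asec_res VU) N).
by rewrite -!map_mxM MN NM map_mx1.
Qed.

Definition gl_res (U V : opens X) (VU : V `<=` U)
    (M : general_linear (algebra_section A U) n) :
  general_linear (algebra_section A V) n :=
  GeneralLinear (gl_res_invertible VU M).

Lemma gl_res_id (U : opens X) (UU : U `<=` U) M : gl_res UU M = M.
Proof.
apply: gl_mx_inj; apply/matrixP => i j; rewrite mxE; apply: sectionP => x Ux /=.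
exact: (@sec_val_irr X A).
Qed.

Lemma gl_res_comp (U V W : opens X) (VU : V `<=` U) (WV : W `<=` V)
  (WU : W `<=` U) M : gl_res WV (gl_res VU M) = gl_res WU M.
Proof.
apply: gl_mx_inj; apply/matrixP => i j; rewrite !mxE; apply: sectionP => x Ux /=.
exact: (@sec_val_irr X A).
Qed.

Lemma gl_resM (U V : opens X) (VU : V `<=` U) M N :
  gl_res VU (M * N)%g = (gl_res VU M * gl_res VU N)%g.
Proof. by apply: gl_mx_inj; exact: map_mxM. Qed.

Definition general_linear_presheaf : group_presheaf X :=
  @GroupPresheaf X (fun U => general_linear (algebra_section A U) n)
    gl_res gl_res_id gl_res_comp gl_resM.

Definition general_linear_sheaf : group_sheaf X :=
  generated_group_sheaf general_linear_presheaf.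

(* the value at x of the germ of a matrix of sections *)
Definition gl_value (x : X) (e : group_stalk general_linear_sheaf x) :
    'M[algebra_stalk A x]_n :=
  let r := repr (e : germ general_linear_presheaf x) in
  map_mx (asec_eval (gr_mem r))
    (gr_sec r : general_linear (algebra_section A (gr_dom r)) n).

Lemma gl_value_germ (U : opens X) (M : general_linear (algebra_section A U) n)
    (x : X) (Ux : oset U x) :
  gl_value (@germ_at X general_linear_presheaf U M x Ux) =
  map_mx (asec_eval Ux) M.
Proof.
rewrite /gl_value; set e := germ_at _ _.
have := germ_reprE (e : germ general_linear_presheaf x).
case: (repr _) => /= V Vx N.
move=> /germ_at_eq [W [WV [WU [Wx E]]]].
apply/matrixP => i j; rewrite !mxE.
have := congr1 (fun L : general_linear (algebra_section A W) n =>
  sec_val (gl_mx L i j : section A W) Wx) E.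
rewrite /= !mxE /= => E'.
rewrite /asec_eval (@sec_val_irr X A _ _ _ _ (WV _ Wx)) E'.
exact: (@sec_val_irr X A).
Qed.

Lemma gl_valueM x (e f : group_stalk general_linear_sheaf x) :
  gl_value (e * f)%g = gl_value e *m gl_value f.
Proof.
have [U [Ux [s [t [-> ->]]]]] :=
  germ_at2 (e : germ general_linear_presheaf x) f.
transitivity (gl_value (@germ_at X general_linear_presheaf U
    (s * t : general_linear (algebra_section A U) n)%g x Ux)).
  apply: (congr1 (@gl_value x)).
  exact: (@germ_at_mul X general_linear_presheaf x U s t Ux).
by rewrite !gl_value_germ; exact: (map_mxM (asec_eval Ux)).
Qed.

Lemma gl_value1 x : gl_value (1%g : group_stalk general_linear_sheaf x) = 1%:M.
Proof.
transitivity (gl_value (@germ_at X general_linear_presheaf (opensT X)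
  (1%g : general_linear (algebra_section A setT) n) x I)); first by [].
by rewrite gl_value_germ map_mx1.
Qed.

Definition power_map (z : tot (fun x => 'cV[algebra_stalk A x]_n)) :
    (X * {ptws 'I_n -> total A})%type :=
  (projT1 z, fun i => @in_total X A _ (projT2 z i 0)).

(* The space A^n over X: the n-fold fibre product of A with itself over X.  The
   first component of power_map matters only when n = 0, where A^0 = X. *)
Definition power_space : space_over X :=
  @SpaceOver X (fun x => 'cV[algebra_stalk A x]_n)
    (Topological.class (initial_topology power_map)).

(* the left action of GL(n, A) on A^n *)
Definition gl_act (x : X) (e : group_stalk general_linear_sheaf x)
  (a : power_space x) : power_space x := gl_value e *m a.

End general_linear_sheaf.

Record representation (K : pzRingType) (X : topologicalType)
    (G : group_sheaf X) (A : algebra_sheaf K X) (n : nat) := Representation {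
  rep_fun :> forall x, group_stalk G x ->
    group_stalk (general_linear_sheaf A n) x;
  rep_mul : forall x (g h : group_stalk G x),
    rep_fun (g * h)%g = (rep_fun g * rep_fun h)%g;
  rep_continuous :
    @fibre_continuous X G (general_linear_sheaf A n) rep_fun }.

Record principal_sheaf (X : topologicalType) (G : group_sheaf X) :=
    PrincipalSheaf {
  ps_sheaf :> sheaf X;
  ps_act : forall x, ps_sheaf x -> group_stalk G x -> ps_sheaf x;
  ps_act1 : forall x (p : ps_sheaf x), ps_act p 1%g = p;
  ps_actM : forall x (p : ps_sheaf x) (g h : group_stalk G x),
    ps_act p (g * h)%g = ps_act (ps_act p g) h;
  ps_act_continuous : @fibre_continuous2 X ps_sheaf G ps_sheaf ps_act;
  ps_index : Type;
  ps_cover : ps_index -> opens X;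
  ps_coverP : forall x, exists i, oset (ps_cover i) x;
  ps_triv : forall i, iso_over ps_sheaf G (ps_cover i);
  ps_triv_equivariant : forall i x (Ux : oset (ps_cover i) x) (p : ps_sheaf x)
    (g : group_stalk G x),
    iso_fun (ps_triv i) Ux (ps_act p g) =
    (iso_fun (ps_triv i) Ux p * g : group_stalk G x)%g }.

Arguments ps_cover {X G} _ _.
Arguments ps_coverP {X G} _ _.
Arguments ps_triv {X G} _ _.

Section associated_sheaf.
Variables (K : pzRingType) (X : topologicalType) (A : algebra_sheaf K X).
Variables (n : nat) (G : group_sheaf X) (P : principal_sheaf G).
Variable phi : representation G A n.

Lemma natural_section_continuous (i : ps_index P) :
  continuous (fun z : ps_cover P i =>
    in_total (iso_inv (ps_triv P i) (set_valP z) (1%g : group_stalk G _))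
    : total P).
Proof.
pose o (z : ps_cover P i) : over G (ps_cover P i) :=
  exist _ (@in_total X G (val z) (1%g : group_stalk G (val z)))
    (mem_set (set_valP z)).
have co : continuous o.
  apply: continuous_comp_initial.
  exact: (@section_const_continuous X G _ _ (@group_one_continuous X G)).
move=> z; have := @continuous_comp _ _ _ o _ z (co z)
  (@iso_inv_continuous _ _ _ _ (ps_triv P i) (o z)).
rewrite /comp /=; congr (continuous_at _ _); apply: funext => y.
by congr in_total; congr iso_inv; exact: Prop_irrelevance.
Qed.

(* the natural section of P over the i-th set of the covering *)
Definition natural_section (i : ps_index P) : section P (ps_cover P i) :=
  @Section X P (ps_cover P i)
    (fun x Ux => iso_inv (ps_triv P i) Ux (1%g : group_stalk G x))
    (@natural_section_continuous i).

Definition assoc_pair (U : set X) : Type :=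
  (section P U * section (power_space A n) U)%type.

Definition assoc_rel (U : set X) (q r : {classic assoc_pair U}) : bool :=
  `[< exists! g : section G U,
        (forall x (Ux : U x),
          sec_val r.1 Ux = ps_act (sec_val q.1 Ux) (sec_val g Ux)) /\
        (forall x (Ux : U x),
          sec_val r.2 Ux =
          gl_act (phi x (sec_val g Ux : group_stalk G x)^-1%g)
            (sec_val q.2 Ux)) >].

Lemma ps_act_free x (p : P x) (g h : group_stalk G x) :
  ps_act p g = ps_act p h -> g = h.
Proof.
have [i Ux] := ps_coverP P x => E; have := congr1 (iso_fun (ps_triv P i) Ux) E.
by rewrite !ps_triv_equivariant => /mulgI.
Qed.

Lemma assoc_relE (U : set X) (q r : assoc_pair U) (g : section G U) :
  (forall x (Ux : U x),
    sec_val r.1 Ux = ps_act (sec_val q.1 Ux) (sec_val g Ux)) ->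
  (forall x (Ux : U x), sec_val r.2 Ux =
    gl_act (phi x (sec_val g Ux : group_stalk G x)^-1%g) (sec_val q.2 Ux)) ->
  assoc_rel q r.
Proof.
move=> h1 h2; apply/asboolP; exists g; split => // g' [h1' _].
by apply: sectionP => x Ux; apply: (@ps_act_free x (sec_val q.1 Ux)); rewrite -h1 -h1'.
Qed.

Lemma rep1 x : phi x (1%g : group_stalk G x) = 1%g.
Proof. by apply: (mulgI (phi x 1%g)); rewrite -rep_mul !mulg1. Qed.

Lemma assoc_relP (U : set X) : equiv_class_of (@assoc_rel U).
Proof.
split.
- move=> q; apply: (@assoc_relE U q q (sec_one G U)) => x Ux /=.
    by rewrite ps_act1.
  by rewrite invg1 rep1 /gl_act gl_value1 mul1mx.
- suff h q r : @assoc_rel U q r -> assoc_rel r q by move=> q r; apply/idP/idP; exact: h.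
  move=> /asboolP [g [[h1 h2] _]].
  apply: (@assoc_relE U r q (sec_inv g)) => x Ux /=.
    by rewrite h1 -ps_actM mulgV ps_act1.
  by rewrite h2 /gl_act mulmxA -gl_valueM -rep_mul mulVg rep1 gl_value1 mul1mx.
- move=> r q t /asboolP [g [[h1 h2] _]] /asboolP [h [[k1 k2] _]].
  apply: (@assoc_relE U q t (sec_mul g h)) => x Ux /=.
    by rewrite k1 h1 -ps_actM.
  by rewrite k2 h2 /gl_act mulmxA -gl_valueM -rep_mul invgM.
Qed.

Canonical assoc_equiv (U : set X) := EquivRelPack (@assoc_relP U).

Definition assoc_quot (U : opens X) : Type := {eq_quot (assoc_equiv U)}.

Definition assoc_class (U : opens X) (s : section P U)
    (a : section (power_space A n) U) : assoc_quot U :=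
  \pi_({eq_quot (assoc_equiv U)}) ((s, a) : {classic assoc_pair U}).

Definition assoc_res (U V : opens X) (VU : V `<=` U) (c : assoc_quot U) :
    assoc_quot V :=
  let q : assoc_pair U := repr c in
  assoc_class (sec_res VU q.1) (sec_res VU q.2).

Lemma assoc_resE (U V : opens X) (VU : V `<=` U) s a :
  assoc_res VU (@assoc_class U s a) =
  assoc_class (sec_res VU s) (sec_res VU a).
Proof.
rewrite /assoc_res; have := @reprK _ {eq_quot (assoc_equiv U)} (assoc_class s a).
case: (repr _) => /= s' a' /eqquotP /asboolP [g [[h1 h2] _]].
apply/eqquotP; apply: (@assoc_relE V _ _ (sec_res VU g)) => x Vx /=.
  exact: h1.
exact: h2.
Qed.

Lemma assoc_quotP (U : opens X) (c : assoc_quot U) :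
  exists s a, c = assoc_class s a.
Proof.
have := @reprK _ {eq_quot (assoc_equiv U)} c.
by case: (repr _) => /= s a <-; exists s, a.
Qed.

Lemma assoc_res_id (U : opens X) (UU : U `<=` U) c : assoc_res UU c = c.
Proof.
have [s [a ->]] := assoc_quotP c; rewrite assoc_resE.
congr assoc_class; apply: sectionP => x Ux /=.
  exact: (@sec_val_irr X P).
exact: (@sec_val_irr X (power_space A n)).
Qed.

Lemma assoc_res_comp (U V W : opens X) (VU : V `<=` U) (WV : W `<=` V)
  (WU : W `<=` U) c : assoc_res WV (assoc_res VU c) = assoc_res WU c.
Proof.
have [s [a ->]] := assoc_quotP c; rewrite !assoc_resE.
congr assoc_class; apply: sectionP => x Ux /=.
  exact: (@sec_val_irr X P).
exact: (@sec_val_irr X (power_space A n)).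
Qed.

Definition assoc_presheaf : presheaf X :=
  Presheaf assoc_res_id assoc_res_comp.

Definition associated_sheaf : sheaf X := generated_sheaf assoc_presheaf.

(* psi is the morphism from A^n to the associated sheaf over the i-th set of the
   covering which is generated by the maps f |-> [s_i, f] *)
Definition generated_by_natural_section (i : ps_index P)
    (psi : iso_over (power_space A n) associated_sheaf (ps_cover P i)) : Prop :=
  forall (V : opens X) (VU : V `<=` ps_cover P i)
    (f : section (power_space A n) V) (x : X) (Vx : oset V x),
  iso_fun psi (VU x Vx) (sec_val f Vx) =
  @germ_at X assoc_presheaf V
    (assoc_class (sec_res VU (natural_section i)) f) x Vx.

End associated_sheaf.

Section modules.
Variables (K : pzRingType) (X : topologicalType) (A : algebra_sheaf K X).

Record module_structure (E : sheaf X) := ModuleStructure {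
  module_class : forall x, GRing.Lmodule.axioms_ (algebra_stalk A x) (E x);
  module_stalk := fun x =>
    @GRing.Lmodule.Pack (algebra_stalk A x) (E x) (module_class x);
  module_add_continuous : @fibre_continuous2 X E E E
    (fun x (u v : module_stalk x) => u + v);
  module_scale_continuous : @fibre_continuous2 X A E E
    (fun x (a : algebra_stalk A x) (u : module_stalk x) => a *: u) }.

Definition locally_free (n : nat) (E : sheaf X) (M : module_structure E) : Prop :=
  forall x, exists (U : opens X) (f : iso_over (power_space A n) E U),
    oset U x /\
    forall y (Uy : oset U y),
      linear (iso_fun f Uy : 'cV[algebra_stalk A y]_n -> module_stalk M y).

End modules.

(* Main.v *)
From HB Require Import structures.
Require Import Defs.
From mathcomp Require Import all_boot all_algebra generic_quotient.
From mathcomp Require Import all_classical reals topology.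

Set Implicit Arguments.
Unset Strict Implicit.
Unset Printing Implicit Defensive.

Import GRing.Theory.
(* This gives section, proj and subIr their meaning for spaces over X again. *)
Import Defs.
Local Open Scope quotient_scope.
Local Open Scope classical_set_scope.
Local Open Scope ring_scope.

(** Everything reduces to one description of the stalks: the stalk of the
associated sheaf E at x is the quotient of P_x * A_x^n by G_x, where g sends
(p, a) to (p g, phi(g^-1) a) ([fibre_class_eq], [fibre_class_surj]).  Only one
implication needs an argument: if (q, b) = (p g, phi(g^-1) a) at the point x,
one extends g to a section of G near x; since P and A^n are etale over X,
sections of either which agree at x agree on a neighbourhood of x, so the
relation holds between sections near x and the germs coincide.  This uses that
A^n is etale ([power_etale]) and that GL(n, A) acts continuously on it
([gl_act_continuous]).

As P_x is a torsor under G_x, every p in P_x yields a bijection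
a |-> [p, a] from A_x^n onto E_x, a frame of E_x.  Two frames p and p g differ
by the invertible matrix phi(g), which acts linearly on A_x^n, so the module
structure transported to E_x along a frame does not depend on the frame
([frame_addE], [frame_scaleE]); this is the well-definedness of the operations.
The map psi_i is the frame given by the natural section s_i, which makes
linearity of psi_i and the formulas for the operations immediate.

The continuity of psi_i, of its inverse and of the operations rests on one
criterion: a fibrewise map whose source is etale is continuous as soon as,
through every point, it carries some local section to a local section
([preimage_open_of_sections]).  All these maps carry sections to sections, because
sections of A^n over V are columns of n sections of A over V and because the
germs of [s_i, f] form a section of E. *)

(** * Continuity on subspaces *)

(** The criterion avoids opens of the subspace U: openness is tested in X, with
the membership proof quantified existentially. *)
Lemma subset_continuous (X T : topologicalType) (U : set X) (f : U -> T) :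
  (forall O : set T, open O ->
    open [set x | exists Ux : U x, O (f (exist _ x (mem_set Ux)))]) ->
  continuous f.
Proof.
move=> fO; apply/continuousP => O oO.
exists [set x | exists Ux : U x, O (f (exist _ x (mem_set Ux)))]; first exact: fO.
apply/seteqP; split => -[x Ux] /=; rewrite /preimage /=.
  by move=> [Ux' /=]; congr (O (f _)); congr exist; exact: Prop_irrelevance.
move=> Of; exists (set_mem Ux).
by move: Of; congr (O (f _)); congr exist; exact: Prop_irrelevance.
Qed.

(** * Sections of etale spaces *)

Section sections_of_spaces.
Variable X : topologicalType.
Implicit Types S T : space_over X.

Lemma section_preimage_open S (V : opens X) (s : section S V) (O : set (total S)) :
  open O -> open [set x | exists Vx : oset V x, O (in_total (sec_val s Vx))].
Proof.
move=> oO; have /continuousP/(_ _ oO) := @sec_continuous _ _ _ s.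
move=> [B oB BE].
suff -> : [set x | exists Vx : oset V x, O (in_total (sec_val s Vx))] = V `&` B.
  by apply: openI => //; exact: osetP.
apply/seteqP; split => [x [Vx Ox]|x [Vx Bx]].
  split=> //.
  have : (set_val @^-1` B) (exist _ x (mem_set Vx) : V).
    by rewrite BE /preimage /= (sec_val_irr s _ Vx).
  by [].
exists Vx.
have : (set_val @^-1` B) (exist _ x (mem_set Vx) : V) by [].
by rewrite BE /preimage /= (sec_val_irr s _ Vx).
Qed.

Definition section_of_open S (V : opens X) (s : forall x, oset V x -> S x)
  (sO : forall O : set (total S), open O ->
     open [set x | exists Vx : oset V x, O (in_total (s x Vx))]) : section S V.
Proof.
refine (@Section X S V s _); apply: subset_continuous => O /sO.
congr open; apply: funext => x; apply/propext; split=> -[Vx Ox]; exists Vx; move: Ox => /=;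
  by congr (O (in_total (s _ _))); exact: Prop_irrelevance.
Defined.

Definition section_image S (V : opens X) (s : section S V) : set (total S) :=
  [set z | exists (x : X) (Vx : oset V x), z = in_total (sec_val s Vx)].

Lemma section_imageE S (V : opens X) (s : section S V) x (u : S x) :
  section_image s (in_total u) <-> exists Vx : oset V x, u = sec_val s Vx.
Proof.
split=> [[y [Vy E]]|[Vx ->]]; last by exists x, Vx.
have xy := existT_inj1 E; subst y.
by exists Vy; exact: (existT_inj2 E).
Qed.

(** This pair of properties follows from being a local homeomorphism
([sheaf_etale]), and passes to fibre products and powers more directly, as no
total local inverse has to be supplied. *)
Record etale S : Prop := Etale {
  etale_section : forall x (u : S x), exists (V : opens X) (s : section S V)
    (Vx : oset V x), sec_val s Vx = u;
  etale_open : forall (V : opens X) (s : section S V), open (section_image s) }.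

(** The points where s and t agree form the preimage under s of the image of t,
which is open. *)
Lemma etale_eq_near S : etale S -> forall (V W : opens X) (s : section S V)
  (t : section S W) x (Vx : oset V x) (Wx : oset W x), sec_val s Vx = sec_val t Wx ->
  exists (N : opens X) (NV : N `<=` V) (NW : N `<=` W), oset N x /\
    sec_res NV s = sec_res NW t.
Proof.
move=> eS V W s t x Vx Wx st.
have oN := section_preimage_open s (etale_open eS t).
pose N := Opens oN.
have NV : N `<=` V by move=> y [].
have NW : N `<=` W by move=> y [Vy /section_imageE[]].
exists N, NV, NW; split.
  by exists Vx; apply/section_imageE; exists Wx.
apply: sectionP => y Ny; have [Vy im] := Ny; have [Wy E] := (section_imageE _ _).1 im => /=.
by rewrite (sec_val_irr s _ Vy) E; exact: sec_val_irr.
Qed.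

Lemma sheaf_proj_continuous (S : sheaf X) : continuous (@proj X S).
Proof.
move=> z; have [O [oO Oz _ [g [_ cp _]]]] := sheaf_lhomeo z.
move: cp; rewrite continuous_open_subspace // => cp.
exact: cp (mem_set Oz).
Qed.

Lemma sheaf_etale (S : sheaf X) : etale S.
Proof.
split.
- move=> x u; have [O [oO Oz oV [g [gK _ cg]]]] := sheaf_lhomeo (in_total u).
  pose V := Opens oV.
  have gP y : oset V y -> O (g y) /\ @proj X S (g y) = y.
    by move=> [z Oz' <-]; rewrite gK //; exact: mem_set.
  have Vx : oset V x by exists (in_total u).
  (* The local inverse g is a map into the total space; it has to be recast as a
     family of elements of the fibres. *)
  pose s y (Vy : oset V y) : S y :=
    ecast y (S y) (gP y Vy).2 (projT2 (g y)).
  have sE y (Vy : oset V y) : in_total (s y Vy) = g y.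
    by rewrite /s; move: (gP y Vy).2; move: (g y) => z e; case: _ / e; case: z.
  have sO (B : set (total S)) : open B ->
      open [set y | exists Vy : oset V y, B (in_total (s y Vy))].
    move=> oB; have := (@continuous_inP _ _ (oset V) g oV).1.
    rewrite -continuous_open_subspace // => /(_ cg _ oB).
    congr open; apply/seteqP; split=> y [Vy].
      by move=> By; exists Vy; rewrite sE.
    by rewrite sE => By; split.
  exists V, (section_of_open sO), Vx.
  have := sE x Vx; rewrite (_ : g x = in_total u); first exact: existT_inj2.
  by have := gK _ (mem_set Oz).
- move=> V s; rewrite openE => _ [x [Vx ->]].
  have [O [oO Oz oV [g [gK _ _]]]] := sheaf_lhomeo (in_total (sec_val s Vx)).
  have oW := section_preimage_open s oO; set W := [set y | _] in oW.
  have oB : open (O `&` (@proj X S @^-1` W)).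
    by apply: openI => //; have /continuousP := @sheaf_proj_continuous S; apply.
  rewrite /interior nbhsE; (* On O the projection is injective, so a point of O over W lies on s. *)
  exists (O `&` (@proj X S @^-1` W)).
    by split=> //; split=> //; exists Vx.
  move=> [y e] [/= Oe [Vy Os]]; exists y, Vy.
  by rewrite -[LHS](gK _ (mem_set Oe)) -[RHS](gK _ (mem_set Os)).
Qed.

Lemma pairing_continuous S T :
  @fibre_continuous2 X S T (fibre_prod S T) (fun x u v => (u, v)).
Proof.
move=> z; have -> : (fun w : total (fibre_prod S T) =>
  @in_total X (fibre_prod S T) _ ((projT2 w).1, (projT2 w).2)) = id.
  by apply: funext => -[x [u v]].
exact: cvg_id.
Qed.

Definition pair_section S T (V : opens X) (s : section S V) (t : section T V) :
    section (fibre_prod S T) V :=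
  @Section X (fibre_prod S T) V (fun x Vx => (sec_val s Vx, sec_val t Vx))
    (@section_op_continuous _ _ _ _ _ _ s t (@pairing_continuous S T)).

Lemma prod_map_continuous S T :
  continuous (@prod_map X S T : total (fibre_prod S T) -> _).
Proof. exact: initial_continuous. Qed.

Lemma fst_continuous S T : @fibre_continuous X (fibre_prod S T) S (fun x => fst).
Proof.
move=> z; exact: (@continuous_comp (total (fibre_prod S T))
  (total S * total T)%type _ (@prod_map X S T) fst z
  (@prod_map_continuous S T z) cvg_fst).
Qed.

Lemma snd_continuous S T : @fibre_continuous X (fibre_prod S T) T (fun x => snd).
Proof.
move=> z; exact: (@continuous_comp (total (fibre_prod S T))
  (total S * total T)%type _ (@prod_map X S T) snd z
  (@prod_map_continuous S T z) cvg_snd).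
Qed.

Lemma etale_section2 S T : etale S -> etale T -> forall x (u : S x) (v : T x),
  exists (V : opens X) (s : section S V) (t : section T V) (Vx : oset V x),
    sec_val s Vx = u /\ sec_val t Vx = v.
Proof.
move=> eS eT x u v.
have [V [s [Vx <-]]] := etale_section eS u.
have [W [t [Wx <-]]] := etale_section eT v.
exists (opensI V W), (sec_res (@subIl X V W) s).
exists (sec_res (@subIr X V W) t), (conj Vx Wx).
by split=> /=; exact: sec_val_irr.
Qed.

Lemma etale_fibre_prod S T : etale S -> etale T -> etale (fibre_prod S T).
Proof.
move=> eS eT; split.
- move=> x [u v]; have [V [s [t [Vx [<- <-]]]]] := etale_section2 eS eT u v.
  by exists V, (pair_section s t), Vx.
- move=> V s.
  (* The image of s is cut out by the open images of its two components. *)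
  pose a : section S V :=
    @Section X S V (fun x Vx => (sec_val s Vx).1) (@section_op1_continuous _ _ _ _ _ s (@fst_continuous S T)).
  pose b : section T V :=
    @Section X T V (fun x Vx => (sec_val s Vx).2) (@section_op1_continuous _ _ _ _ _ s (@snd_continuous S T)).
  have /continuousP fo := @fst_continuous S T.
  have /continuousP so := @snd_continuous S T.
  have := openI (fo _ (etale_open eS a)) (so _ (etale_open eT b)).
  congr open; apply/seteqP; split=> [[x [u v]]|_ [x [Vx ->]]].
    move=> [/section_imageE[/= Vx ->] /section_imageE[/= Vx' ->]].
    apply/section_imageE; exists Vx; rewrite (sec_val_irr s Vx' Vx).
    by case: (sec_val s Vx).
  by split; apply/section_imageE; exists Vx.
Qed.

(** The sections s through a point have open images, so continuity of f at that
point is continuity of f along s, that is of the section t. *)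
Lemma preimage_open_of_sections S T (U : set X) (f : forall x, U x -> S x -> T x) :
  etale S ->
  (forall x (Ux : U x) (u : S x), exists (V : opens X) (VU : V `<=` U)
     (s : section S V) (t : section T V),
     (exists Vx : oset V x, sec_val s Vx = u) /\
     forall y (Vy : oset V y), sec_val t Vy = f y (VU y Vy) (sec_val s Vy)) ->
  forall O : set (total T), open O ->
  open [set z : total S | exists Uz : U (projT1 z),
    O (in_total (f _ Uz (projT2 z)))].
Proof.
move=> eS fs O oO; rewrite openE => -[x u] /= [Ux Ou].
have [V [VU [s [t [[Vx su] tE]]]]] := fs x Ux u; subst u.
have oN := section_preimage_open t oO; set N := [set y | _] in oN.
have NV : Opens oN `<=` V by move=> y [].
rewrite /interior nbhsE.
exists (section_image (sec_res NV s : section S (Opens oN))).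
  split; first exact: etale_open.
  have Nx : N x by exists Vx; rewrite tE (Prop_irrelevance (VU x Vx) Ux).
  by apply/section_imageE; exists Nx => /=; exact: sec_val_irr.
move=> _ [y [[Vy Oy] ->]]; exists (VU y Vy) => /=.
by rewrite (sec_val_irr s _ Vy) -tE.
Qed.

Lemma continuous_over_of_sections S T (U : set X)
    (f : forall x, U x -> S x -> T x) :
  etale S ->
  (forall x (Ux : U x) (u : S x), exists (V : opens X) (VU : V `<=` U)
     (s : section S V) (t : section T V),
     (exists Vx : oset V x, sec_val s Vx = u) /\
     forall y (Vy : oset V y), sec_val t Vy = f y (VU y Vy) (sec_val s Vy)) ->
  continuous_over f.
Proof.
move=> eS fs; apply: subset_continuous => O oO.
have := preimage_open_of_sections eS fs oO.
congr open; apply/seteqP; split => -[x u] /= [Uz Oz].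
  exists Uz; move: Oz; congr (O (in_total (f _ _ _))); exact: Prop_irrelevance.
exists Uz; move: Oz; congr (O (in_total (f _ _ _))); exact: Prop_irrelevance.
Qed.

Lemma fibre_continuous_of_sections S T (f : forall x, S x -> T x) :
  etale S ->
  (forall x (u : S x), exists (V : opens X)
     (s : section S V) (t : section T V),
     (exists Vx : oset V x, sec_val s Vx = u) /\
     forall y (Vy : oset V y), sec_val t Vy = f y (sec_val s Vy)) ->
  fibre_continuous f.
Proof.
move=> eS fs; apply/continuousP => O oO.
have := @preimage_open_of_sections S T setT (fun x _ => f x) eS _ O oO.
rewrite (_ : [set z | _] =
  (fun z : total S => in_total (f (projT1 z) (projT2 z)) : total T) @^-1` O).
  apply => x _ u; have [V [s [t [su tE]]]] := fs x u.
  by exists V, (fun _ _ => I), s, t.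
by apply/seteqP; split => [z [_]|z Oz] //; exists I.
Qed.

End sections_of_spaces.

(** * The sheaf of n-tuples *)

Lemma continuous_into_ptws (I : Type) (T Y : topologicalType)
    (f : Y -> {ptws I -> T}) :
  (forall i, continuous (fun y => f y i)) -> continuous f.
Proof.
move=> fi y; apply/cvg_sup => i.
have := @continuous_comp_initial _ _ _ (fun g : I -> T => g i) f (fi i).
exact.
Qed.

Lemma open_bigcap_fin (I : finType) (T : topologicalType) (B : I -> set T) :
  (forall i, open (B i)) -> open (\bigcap_(i in [set: I]) B i).
Proof.
move=> oB; rewrite openE => x Bx; rewrite /interior.
have : \forall y \near x, forall i, B i y.
  by apply: filter_forall => i; apply: open_nbhs_nbhs; split => //; exact: Bx.
by apply: filterS => y By i _.
Qed.

Section power_space_sections.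
Variables (K : pzRingType) (X : topologicalType) (A : algebra_sheaf K X).
Variable n : nat.
Local Notation An := (power_space A n).

Lemma power_map_continuous :
  continuous (@power_map K X A n : total An -> _).
Proof. exact: initial_continuous. Qed.

Lemma power_proj_continuous : continuous (@proj X An).
Proof.
move=> z; exact: (@continuous_comp (total An)
  (X * {ptws 'I_n -> total A})%type X (@power_map K X A n) fst z
  (@power_map_continuous z) cvg_fst).
Qed.

Lemma coordinate_continuous (i : 'I_n) :
  @fibre_continuous X An A (fun x (a : 'cV[algebra_stalk A x]_n) => a i 0).
Proof.
move=> z; have c2 := @continuous_comp (total An)
  (X * {ptws 'I_n -> total A})%type {ptws 'I_n -> total A} (@power_map K X A n) snd z
  (@power_map_continuous z) cvg_snd.
have c3 : {for snd (power_map z), continuous (fun g : {ptws 'I_n -> total A} => g i)}.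
  exact: (@proj_continuous 'I_n (fun=> total A) i).
exact: (continuous_comp (c2 _) c3).
Qed.

(** Together with [power_section], this identifies sections of A^n over V with
columns over the ring A(V), so that operations on sections of A^n are matrix
operations. *)
Definition coordinates (V : opens X) (f : section An V) :
    'cV[algebra_section A V]_n :=
  \col_i @Section X A V (fun x Vx => (sec_val f Vx : 'cV[algebra_stalk A x]_n) i 0)
    (@section_op1_continuous X An A _ V f (@coordinate_continuous i)).

Lemma power_section_continuous (V : opens X) (F : 'cV[algebra_section A V]_n) :
  continuous (fun z : V =>
    @in_total X An _ (map_mx (asec_eval (set_valP z)) F)).
Proof.
apply: (@continuous_comp_initial _ _ _ (@power_map K X A n)) => z.
pose F' (y : V) : {ptws 'I_n -> total A} :=
  fun i => @in_total X A _ (asec_eval (set_valP y) (F i 0)).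
have cF : continuous F'.
  by apply: continuous_into_ptws => i; exact: (@sec_continuous X A V (F i 0)).
have -> : @power_map K X A n \o (fun y : V =>
    @in_total X An _ (map_mx (asec_eval (set_valP y)) F)) =
    fun y : V => (\val y, F' y).
  apply: funext => y; congr (_, _); apply: funext => i.
  by rewrite /F' /= mxE.
exact: (@cvg_pair _ _ _ _ _ _ _ _ _ _ _
  (@initial_continuous _ _ (@set_val X V) z) (cF z)).
Qed.

Definition power_section (V : opens X) (F : 'cV[algebra_section A V]_n) :
    section An V :=
  @Section X An V (fun x Vx => map_mx (asec_eval Vx) F)
    (@power_section_continuous V F).

Lemma coordinatesE (V : opens X) (f : section An V) x (Vx : oset V x) :
  sec_val f Vx = map_mx (asec_eval Vx) (coordinates f) :> 'cV[algebra_stalk A x]_n.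
Proof. by apply/matrixP => i j; rewrite ord1 !mxE. Qed.

(** The image of a section f over V consists of the tuples over V whose i-th entry
lies in the open image of the i-th coordinate of f, for every i.  The condition
over V is needed when n = 0. *)
Lemma power_etale : etale An.
Proof.
split.
- move=> x a.
  suff [V [F [Vx FE]]] : exists (V : opens X) (F : 'cV[algebra_section A V]_n)
      (Vx : oset V x), map_mx (asec_eval Vx) F = a.
    by exists V, (power_section F), Vx.
  have /choice[Vi Fi] (i : 'I_n) : exists V : opens X,
      exists (s : section A V) (Vx : oset V x), sec_val s Vx = a i 0.
    exact: (etale_section (sheaf_etale A)).
  have oV := open_bigcap_fin (fun i => osetP (Vi i)).
  pose V := Opens oV.
  have Vx : oset V x by move=> i _; have [s [Vx _]] := Fi i.
  have VV i : V `<=` Vi i by move=> y; apply.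
  pose s i : section A (Vi i) := projT1 (cid (Fi i)).
  have sE i (Vix : oset (Vi i) x) : sec_val (s i) Vix = a i 0.
    have [Vix' <-] := projT2 (cid (Fi i)); exact: sec_val_irr.
  exists V, (\col_i sec_res (VV i) (s i)), Vx.
  by apply/matrixP => i j; rewrite ord1 !mxE /asec_eval /= sE.
- move=> V f.
  have /continuousP pc := @power_proj_continuous.
  have cc i := (continuousP _).1 (@coordinate_continuous i) _
     (etale_open (sheaf_etale A) (coordinates f i 0)).
  have oB := open_bigcap_fin cc.
  have := openI (pc _ (osetP V)) oB; congr open.
  apply/seteqP; split=> [[x a] [/= Vx h]|_ [x [Vx ->]]]; last first.
    split=> // i _; apply/section_imageE; exists Vx.
    by rewrite !mxE.
  apply/section_imageE; exists Vx; apply/matrixP => i j; rewrite ord1.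
  have [Vx' ->] := (section_imageE _ _).1 (h i I).
  by rewrite (Prop_irrelevance Vx' Vx) mxE.
Qed.

End power_space_sections.

(** * Germs as sections, and the action of the general linear sheaf *)

Section germ_sections.
Variables (X : topologicalType) (F : presheaf X).

Definition germ_section (U : opens X) (s : F U) : section (generated_space F) U.
Proof.
apply: (@section_of_open X (generated_space F) U (fun x Ux => germ_at s Ux)).
move=> O /germ_openP oO; rewrite openE => x [Ux Ox].
have [V [t [Vx [/germ_at_eq[W [WU [WV [Wx E]]]] tO]]]] := oO _ _ Ox.
rewrite /interior nbhsE; exists W; first by split=> //; exact: osetP.
move=> y Wy; exists (WU y Wy).
rewrite -(germ_at_res WU s Wy) E (germ_at_res WV t Wy (WV y Wy)).
exact: tO.
Defined.

End germ_sections.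

Section gl_action.
Variables (K : pzRingType) (X : topologicalType) (A : algebra_sheaf K X).
Variable n : nat.
Local Notation An := (power_space A n).
Local Notation GLn := (general_linear_sheaf A n).

(** Near a point, a section of GL(n, A) is a matrix of sections of A, and the
product of a matrix by a column of sections is again a column of sections. *)
Lemma gl_act_continuous : @fibre_continuous2 X GLn An An
  (fun x e a => gl_act e a).
Proof.
apply: fibre_continuous_of_sections.
  by apply: etale_fibre_prod; [exact: sheaf_etale|exact: power_etale].
move=> x [e a].
have [U [M [Ux ->]]] := germ_atP (e : germ (general_linear_presheaf A n) x).
have [V [f [Vx <-]]] := etale_section (@power_etale K X A n) a.
pose W := opensI U V.
have WU : W `<=` U := @subIl X U V; have WV : W `<=` V := @subIr X U V.
have Wx : oset W x by [].
pose MW : general_linear (algebra_section A W) n := gl_res WU M.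
exists W, (pair_section
  (@germ_section X (general_linear_presheaf A n) W MW : section GLn W)
  (sec_res WV f)), (power_section (MW *m coordinates (sec_res WV f))).
split.
  exists Wx => /=; congr (_, _).
    exact: (@germ_at_res X (general_linear_presheaf A n)).
  exact: (@sec_val_irr X An).
move=> y Wy /=; rewrite map_mxM /= /gl_act.
congr (_ *m _); first exact/esym/gl_value_germ.
exact/esym/(coordinatesE (sec_res WV f)).
Qed.

End gl_action.

(** * Stalks of the associated sheaf *)

Section stalks_of_the_associated_sheaf.
Variables (K : pzRingType) (X : topologicalType) (A : algebra_sheaf K X).
Variables (n : nat) (G : group_sheaf X) (P : principal_sheaf G).
Variable phi : representation G A n.
Local Notation An := (power_space A n).
Local Notation E := (associated_sheaf P phi).
Local Notation Q := (assoc_presheaf P phi).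

Definition act_section (V : opens X) (s : section P V) (g : section G V) :
    section P V :=
  @Section X P V (fun x Vx => ps_act (sec_val s Vx) (sec_val g Vx))
    (@section_op_continuous X P G P _ V s g (@ps_act_continuous X G P)).

Definition rep_section (V : opens X) (g : section G V) :
    section (general_linear_sheaf A n) V :=
  @Section X (general_linear_sheaf A n) V (fun x Vx => phi x (sec_val g Vx))
    (@section_op1_continuous X G (general_linear_sheaf A n) _ V g
      (@rep_continuous _ _ _ _ _ phi)).

Definition gl_act_section (V : opens X)
    (e : section (general_linear_sheaf A n) V) (f : section An V) :
    section An V :=
  @Section X An V (fun x Vx => gl_act (sec_val e Vx) (sec_val f Vx))
    (@section_op_continuous X (general_linear_sheaf A n) An An _ V e f
      (@gl_act_continuous K X A n)).

Definition assoc_germ (U : opens X) (s : section P U) (f : section An U) x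
  (Ux : oset U x) : germ Q x := @germ_at X Q U (assoc_class phi s f) x Ux.

(** The values at x determine the sections s and f on a neighbourhood of x, as P and
A^n are etale. *)
Lemma assoc_germ_congr (U V : opens X) s f t h x (Ux : oset U x) (Vx : oset V x) :
  sec_val s Ux = sec_val t Vx -> sec_val f Ux = sec_val h Vx ->
  @assoc_germ U s f x Ux = @assoc_germ V t h x Vx.
Proof.
move=> /(etale_eq_near (sheaf_etale P))[M [MU [MV [Mx stM]]]].
move=> /(etale_eq_near (@power_etale K X A n))[N [NU [NV [Nx fhN]]]].
pose W := opensI M N.
have WM : W `<=` M := @subIl X M N; have WN : W `<=` N := @subIr X M N.
apply/germ_at_eq; exists W, (subset_trans WM MU), (subset_trans WM MV).
split=> //; rewrite /= !assoc_resE; congr assoc_class; apply: sectionP => y Wy /=.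
  have := congr1 (fun r : section P M => sec_val r (WM y Wy)) stM.
  rewrite /= => E1; rewrite (sec_val_irr s _ (MU _ (WM y Wy))) E1.
  exact: sec_val_irr.
have := congr1 (fun r : section An N => sec_val r (WN y Wy)) fhN.
rewrite /= => E1; rewrite (sec_val_irr f _ (NU _ (WN y Wy))) E1.
exact: (@sec_val_irr X An).
Qed.

(** The relation which defines Q(U) involves a section of G; on germs a single
element of G_x suffices, because it extends to a section near x and the
remaining equalities spread from x to a neighbourhood. *)
Lemma assoc_germ_eq (U V : opens X) s f t h x (Ux : oset U x) (Vx : oset V x) :
  @assoc_germ U s f x Ux = @assoc_germ V t h x Vx <->
  exists g : group_stalk G x, sec_val t Vx = ps_act (sec_val s Ux) g /\
    sec_val h Vx = gl_act (phi x g^-1%g) (sec_val f Ux).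
Proof.
split.
  move=> /germ_at_eq[W [WU [WV [Wx]]]].
  rewrite /= !assoc_resE => /eqquotP/asboolP[g [[/(_ x Wx) /= ts /(_ x Wx) /= hf] _]].
  exists (sec_val g Wx); split.
    by rewrite (sec_val_irr t _ (WV x Wx)) ts (sec_val_irr s _ Ux).
  by rewrite (sec_val_irr h _ (WV x Wx)) hf (sec_val_irr f _ Ux).
move=> [g [ts hf]].
have [W [gW [Wx gE]]] := etale_section (sheaf_etale G) g; subst g.
pose N := opensI U W.
have NU : N `<=` U := @subIl X U W; have NW : N `<=` W := @subIr X U W.
have Nx : oset N x by [].
transitivity (assoc_germ (sec_res NU s) (sec_res NU f) Nx).
  apply: assoc_germ_congr => /=; first exact: sec_val_irr.
  exact: (@sec_val_irr X An).
pose g := sec_res NW gW.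
transitivity (assoc_germ (act_section (sec_res NU s) g)
   (gl_act_section (rep_section (sec_inv g)) (sec_res NU f)) Nx).
  apply: (congr1 (fun c => @germ_at X Q N c x Nx)); apply/eqquotP; exact: (@assoc_relE _ _ _ _ _ _ _ _ _ _ g).
apply: assoc_germ_congr => /=.
  by rewrite ts (sec_val_irr s _ Ux) (sec_val_irr gW _ Wx).
by rewrite hf (sec_val_irr f _ Ux) (sec_val_irr gW _ Wx).
Qed.

Lemma fibre_class_exists x (p : P x) (a : An x) : exists e : E x,
  forall (U : opens X) (s : section P U) (f : section An U) (Ux : oset U x),
    sec_val s Ux = p -> sec_val f Ux = a -> assoc_germ s f Ux = e.
Proof.
have [V [t [h [Vx [<- <-]]]]] :=
  etale_section2 (sheaf_etale P) (@power_etale K X A n) p a.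
exists (assoc_germ t h Vx) => U s f Ux st fh; exact: assoc_germ_congr.
Qed.

(** The class [p, a] of E_x, for p in P_x and a in A_x^n. *)
Definition fibre_class x (p : P x) (a : An x) : E x :=
  projT1 (cid (fibre_class_exists p a)).

Lemma assoc_germE (U : opens X) (s : section P U) (f : section An U) x
  (Ux : oset U x) :
  assoc_germ s f Ux = fibre_class (sec_val s Ux) (sec_val f Ux).
Proof. by rewrite /fibre_class; case: cid => e /= ->. Qed.

Lemma fibre_class_eq x (p q : P x) (a b : An x) :
  fibre_class p a = fibre_class q b <->
  exists g : group_stalk G x, q = ps_act p g /\ b = gl_act (phi x g^-1%g) a.
Proof.
have [V [t [f [Vx [<- <-]]]]] :=
  etale_section2 (sheaf_etale P) (@power_etale K X A n) p a.
have [W [s [h [Wx [<- <-]]]]] :=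
  etale_section2 (sheaf_etale P) (@power_etale K X A n) q b.
rewrite -!assoc_germE; exact: assoc_germ_eq.
Qed.

Lemma fibre_class_surj x (e : E x) : exists p a, e = fibre_class p a.
Proof.
have [U [c [Ux ->]]] := germ_atP e; have [s [f ->]] := assoc_quotP c.
by exists (sec_val s Ux), (sec_val f Ux); exact: assoc_germE.
Qed.

End stalks_of_the_associated_sheaf.

(** * Transport of a module structure along a bijection *)

Section transport.
Variables (R : pzRingType) (V : lmodType R) (T : Type) (f : V -> T) (g : T -> V).

Definition transported (fK : cancel f g) (gK : cancel g f) : Type := T.

Variables (fK : cancel f g) (gK : cancel g f).
Local Notation TV := (transported fK gK).
Implicit Types u v w : TV.

Let add u v : TV := f (g u + g v).
Let opp u : TV := f (- g u).
Let scale (a : R) u : TV := f (a *: g u).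

Fact transported_addA : associative add.
Proof. by move=> u v w; rewrite /add !fK addrA. Qed.
Fact transported_addC : commutative add.
Proof. by move=> u v; rewrite /add addrC. Qed.
Fact transported_add0 : left_id (f 0 : TV) add.
Proof. by move=> u; rewrite /add fK add0r gK. Qed.
Fact transported_addN : left_inverse (f 0 : TV) opp add.
Proof. by move=> u; rewrite /add /opp fK addNr. Qed.

HB.instance Definition _ := gen_eqMixin TV.
HB.instance Definition _ := gen_choiceMixin TV.
HB.instance Definition _ := GRing.isZmodule.Build TV
  transported_addA transported_addC transported_add0 transported_addN.

Fact transported_scaleA a b u : scale a (scale b u) = scale (a * b) u.
Proof. by rewrite /scale fK scalerA. Qed.
Fact transported_scale1 : left_id 1 scale.
Proof. by move=> u; rewrite /scale scale1r gK. Qed.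
Fact transported_scaleDr : right_distributive scale +%R.
Proof. by move=> a u v; rewrite /scale /GRing.add /= /add !fK scalerDr. Qed.
Fact transported_scaleDl u : {morph scale^~ u : a b / a + b >-> (a + b : TV)}.
Proof. by move=> a b; rewrite /scale scalerDl /GRing.add /= /add !fK. Qed.

HB.instance Definition _ := GRing.Zmodule_isLmodule.Build R TV
  transported_scaleA transported_scale1 transported_scaleDr transported_scaleDl.

End transport.

(** * Frames of the associated sheaf *)

Section frames.
Variables (K : pzRingType) (X : topologicalType) (A : algebra_sheaf K X).
Variables (n : nat) (G : group_sheaf X) (P : principal_sheaf G).
Variable phi : representation G A n.
Local Notation An := (power_space A n).
Local Notation E := (associated_sheaf P phi).

(** A local trivialization carries the action on P_x to the right translations
of G_x. *)
Lemma ps_act_transitive x (p q : P x) : exists g : group_stalk G x, q = ps_act p g.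
Proof.
have [i Ux] := ps_coverP P x.
pose h r : group_stalk G x := iso_fun (ps_triv P i) Ux r.
have hK : cancel h (iso_inv (ps_triv P i) Ux) by exact: iso_funK.
exists ((h p)^-1 * h q)%g; rewrite -[LHS]hK -[RHS]hK; congr iso_inv.
by rewrite {2}/h ps_triv_equivariant mulgA mulgV mul1g.
Qed.

Lemma fibre_class_act x (p : P x) (g : group_stalk G x) (a : An x) :
  fibre_class phi (ps_act p g) a = fibre_class phi p (gl_act (phi x g) a).
Proof.
apply/esym/fibre_class_eq; exists g; split=> //.
by rewrite /gl_act mulmxA -gl_valueM -rep_mul mulVg rep1 gl_value1 mul1mx.
Qed.

Lemma fibre_class_inj x (p : P x) : injective (@fibre_class K X A n G P phi x p).
Proof.
move=> a b /fibre_class_eq[g [pg ->]].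
have -> : g = 1%g by apply: (@ps_act_free X G P x p); rewrite -pg ps_act1.
by rewrite invg1 rep1 /gl_act gl_value1 mul1mx.
Qed.

Lemma fibre_class_onto x (p : P x) (e : E x) : exists a, fibre_class phi p a = e.
Proof.
have [q [b ->]] := fibre_class_surj e; have [g ->] := ps_act_transitive p q.
by exists (gl_act (phi x g) b); rewrite fibre_class_act.
Qed.

Definition fibre_coord x (p : P x) (e : E x) : An x :=
  projT1 (cid (fibre_class_onto p e)).

Lemma fibre_coordK x (p : P x) :
  cancel (@fibre_coord x p) (@fibre_class K X A n G P phi x p).
Proof. by move=> e; rewrite /fibre_coord; case: cid. Qed.

Lemma fibre_classK x (p : P x) :
  cancel (@fibre_class K X A n G P phi x p) (@fibre_coord x p).
Proof. by move=> a; apply: fibre_class_inj (fibre_coordK _ _). Qed.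

Lemma fibre_coord_act x (p : P x) (g : group_stalk G x) (e : E x) :
  fibre_coord p e = gl_act (phi x g) (fibre_coord (ps_act p g) e).
Proof.
apply: (@fibre_class_inj x p); rewrite -fibre_class_act.
by rewrite !fibre_coordK.
Qed.

Definition frame_add x (p : P x) (u v : E x) : E x :=
  fibre_class phi p ((fibre_coord p u : 'cV[algebra_stalk A x]_n) + fibre_coord p v).

Definition frame_scale x (p : P x) (a : algebra_stalk A x) (u : E x) : E x :=
  fibre_class phi p (a *: (fibre_coord p u : 'cV[algebra_stalk A x]_n)).

(** Changing the frame from p to p g changes coordinates by the matrix phi(g),
which is additive. *)
Lemma frame_addE x (p q : P x) : frame_add p =2 frame_add q.
Proof.
move=> u v; have [g ->] := ps_act_transitive p q.
rewrite /frame_add fibre_class_act !(fibre_coord_act p g).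
by congr fibre_class; rewrite /gl_act mulmxDr.
Qed.

Lemma frame_scaleE x (p q : P x) : frame_scale p =2 frame_scale q.
Proof.
move=> a u; have [g ->] := ps_act_transitive p q.
rewrite /frame_scale fibre_class_act !(fibre_coord_act p g).
by congr fibre_class; rewrite /gl_act scalemxAr.
Qed.

Section frame_iso.
Variable i : ps_index P.
Local Notation U := (ps_cover P i).
Local Notation s := (natural_section i).

(** The map psi_i carries the section f of A^n to the germs of [s_i, f]. *)
Lemma frame_fun_continuous :
  @continuous_over X An E U (fun x Ux a => fibre_class phi (sec_val s Ux) a).
Proof.
apply: continuous_over_of_sections; first exact: power_etale.
move=> x Ux a; have [V [f [Vx fE]]] := etale_section (@power_etale K X A n) a.
pose N := opensI U V.
have NU : N `<=` U := @subIl X U V; have NV : N `<=` V := @subIr X U V.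
exists N, NU, (sec_res NV f).
exists (germ_section (assoc_class phi (sec_res NU s) (sec_res NV f)
                       : assoc_presheaf P phi N)).
split; first by exists (conj Ux Vx); rewrite -fE /=; exact: (@sec_val_irr X An).
by move=> y Ny; exact: assoc_germE.
Qed.

Lemma frame_inv_continuous :
  @continuous_over X E An U (fun x Ux e => fibre_coord (sec_val s Ux) e).
Proof.
apply: continuous_over_of_sections; first exact: sheaf_etale.
move=> x Ux e; have [V [f [Vx fE]]] :=
  etale_section (@power_etale K X A n) (fibre_coord (sec_val s Ux) e).
pose N := opensI U V.
have NU : N `<=` U := @subIl X U V; have NV : N `<=` V := @subIr X U V.
exists N, NU.
exists (germ_section (assoc_class phi (sec_res NU s) (sec_res NV f)
                       : assoc_presheaf P phi N)), (sec_res NV f).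
split.
  exists (conj Ux Vx); rewrite -[e](fibre_coordK (sec_val s Ux)) -fE.
  apply: etrans (assoc_germE _ _ _ _) _.
  congr fibre_class; first exact: (sec_val_irr s).
  exact: (sec_val_irr f).
move=> y Ny; rewrite -[LHS](fibre_classK (sec_val s (NU y Ny))).
by congr fibre_coord; exact/esym/assoc_germE.
Qed.

Definition frame_iso : iso_over An E U :=
  @IsoOver X An E U
    (fun x Ux a => fibre_class phi (sec_val s Ux) a)
    (fun x Ux e => fibre_coord (sec_val s Ux) e)
    (fun x Ux => fibre_classK (sec_val s Ux))
    (fun x Ux => fibre_coordK (sec_val s Ux))
    frame_fun_continuous frame_inv_continuous.

Lemma frame_isoP : generated_by_natural_section frame_iso.
Proof. by move=> V VU f x Vx; apply/esym/assoc_germE. Qed.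

End frame_iso.
End frames.

(** * The module structure of the associated sheaf *)

Section associated_module.
Variables (K : pzRingType) (X : topologicalType) (A : algebra_sheaf K X).
Variables (n : nat) (G : group_sheaf X) (P : principal_sheaf G).
Variable phi : representation G A n.
Local Notation An := (power_space A n).
Local Notation E := (associated_sheaf P phi).

Lemma ps_inhabited x : exists p : P x, True.
Proof.
by have [i Ux] := ps_coverP P x; exists (sec_val (natural_section i) Ux).
Qed.

(** The choice of a base point in each fibre is not continuous in x; it only serves
to define the operations, which do not depend on it. *)
Definition base_point x : P x := projT1 (cid (ps_inhabited x)).

Definition assoc_module_class x : GRing.Lmodule.axioms_ (algebra_stalk A x) (E x) :=
  GRing.Lmodule.class (@transported (algebra_stalk A x) 'cV[algebra_stalk A x]_n
    (E x) _ _ (fibre_classK phi (base_point x)) (@fibre_coordK _ _ _ _ _ _ phi _ (base_point x))).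

Definition frame_section (i : ps_index P) (V : opens X)
    (VU : V `<=` ps_cover P i) (f : section An V) : section E V :=
  germ_section (assoc_class phi (sec_res VU (natural_section i)) f
                  : assoc_presheaf P phi V).

Lemma frame_sectionE i (V : opens X) (VU : V `<=` ps_cover P i)
    (f : section An V) x (Vx : oset V x) (Ux : oset (ps_cover P i) x) :
  sec_val (frame_section VU f) Vx =
  fibre_class phi (sec_val (natural_section i) Ux) (sec_val f Vx).
Proof.
apply: etrans (assoc_germE _ _ _ _) _; congr fibre_class.
exact: (sec_val_irr (natural_section i)).
Qed.

(** In the frame s_i, addition carries the pair of sections with coordinates f, h to
the section with coordinates f + h. *)
Lemma frame_add_continuous :
  @fibre_continuous2 X E E E (fun x u v => frame_add (base_point x) u v).
Proof.
apply: fibre_continuous_of_sections.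
  by apply: etale_fibre_prod; exact: sheaf_etale.
move=> x [u v]; have [i Ux] := ps_coverP P x.
pose p := sec_val (natural_section i) Ux.
have [V [f [h [Vx [fE hE]]]]] := etale_section2 (@power_etale K X A n)
  (@power_etale K X A n) (fibre_coord p u) (fibre_coord p v).
pose N := opensI (ps_cover P i) V.
have NU : N `<=` ps_cover P i := @subIl X _ V.
have NV : N `<=` V := @subIr X _ V.
pose fN := sec_res NV f; pose hN := sec_res NV h.
exists N, (pair_section (frame_section NU fN) (frame_section NU hN)).
exists (frame_section NU (power_section (coordinates fN + coordinates hN))).
split.
  exists (conj Ux Vx); apply: (congr2 pair).
    rewrite (frame_sectionE _ _ _ Ux) -[RHS](fibre_coordK p) -fE.
    by congr fibre_class; exact: (sec_val_irr f).
  rewrite (frame_sectionE _ _ _ Ux) -[RHS](fibre_coordK p) -hE.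
  by congr fibre_class; exact: (sec_val_irr h).
move=> y Ny; set q := sec_val (natural_section i) (NU y Ny).
apply: etrans (frame_addE q _ (sec_val (frame_section NU fN) Ny)
  (sec_val (frame_section NU hN) Ny)).
rewrite /frame_add !(frame_sectionE _ _ _ (NU y Ny)) !fibre_classK.
congr fibre_class; rewrite /= map_mxD.
congr (_ + _); first exact/esym/(coordinatesE fN).
exact/esym/(coordinatesE hN).
Qed.

Lemma frame_scale_continuous :
  @fibre_continuous2 X A E E (fun x a u => frame_scale (base_point x) a u).
Proof.
apply: fibre_continuous_of_sections.
  by apply: etale_fibre_prod; exact: sheaf_etale.
move=> x [a u]; have [i Ux] := ps_coverP P x.
pose p := sec_val (natural_section i) Ux.
have [V [c [f [Vx [cE fE]]]]] := etale_section2 (sheaf_etale A)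
  (@power_etale K X A n) a (fibre_coord p u).
pose N := opensI (ps_cover P i) V.
have NU : N `<=` ps_cover P i := @subIl X _ V.
have NV : N `<=` V := @subIr X _ V.
pose cN : algebra_section A N := sec_res NV c; pose fN := sec_res NV f.
exists N, (pair_section cN (frame_section NU fN)).
exists (frame_section NU (power_section (cN *: coordinates fN))).
split.
  exists (conj Ux Vx); apply: (congr2 pair).
    by rewrite -cE; exact: (sec_val_irr c).
  rewrite (frame_sectionE _ _ _ Ux) -[RHS](fibre_coordK p) -fE.
  by congr fibre_class; exact: (sec_val_irr f).
move=> y Ny; set q := sec_val (natural_section i) (NU y Ny).
apply: etrans (frame_scaleE q _ (sec_val cN Ny) (sec_val (frame_section NU fN) Ny)).
rewrite /frame_scale !(frame_sectionE _ _ _ (NU y Ny)) fibre_classK.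
congr fibre_class; rewrite /= map_mxZ.
by congr (_ *: _); exact/esym/(coordinatesE fN).
Qed.

Definition assoc_module : module_structure A E :=
  @ModuleStructure K X A E assoc_module_class
    frame_add_continuous frame_scale_continuous.

Lemma assoc_module_addE x (p : P x) (u v : module_stalk assoc_module x) :
  u + v = frame_add p u v.
Proof. exact: (@frame_addE K X A n G P phi x (base_point x) p u v). Qed.

Lemma assoc_module_scaleE x (p : P x) (a : algebra_stalk A x)
    (u : module_stalk assoc_module x) : a *: u = frame_scale p a u.
Proof. exact: (@frame_scaleE K X A n G P phi x (base_point x) p a u). Qed.

Lemma assoc_module_locally_free : locally_free n assoc_module.
Proof.
move=> x; have [i Ux] := ps_coverP P x.
exists (ps_cover P i), (frame_iso phi i); split=> // y Uy c a b.
pose p := sec_val (natural_section i) Uy.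
rewrite (assoc_module_scaleE p) (assoc_module_addE p).
by rewrite /frame_add /frame_scale !fibre_classK.
Qed.

End associated_module.

Theorem theorem1 (R : realType) (k : ground) (X : topologicalType)
    (A : algebra_sheaf (ground_field R k) X) (n : nat) (G : group_sheaf X)
    (P : principal_sheaf G) (phi : representation G A n) :
  exists psi : forall i : ps_index P,
      iso_over (power_space A n) (associated_sheaf P phi) (ps_cover P i),
    (forall i, generated_by_natural_section (psi i)) /\
    exists M : module_structure A (associated_sheaf P phi),
      [/\ forall i x (Ux : oset (ps_cover P i) x) (u v : module_stalk M x),
            u + v = iso_fun (psi i) Ux
              ((iso_inv (psi i) Ux u : 'cV[algebra_stalk A x]_n) +
               iso_inv (psi i) Ux v),
          forall i x (Ux : oset (ps_cover P i) x) (a : algebra_stalk A x)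
            (u : module_stalk M x),
            a *: u = iso_fun (psi i) Ux
              (a *: (iso_inv (psi i) Ux u : 'cV[algebra_stalk A x]_n)) &
          locally_free n M].
Proof.
exists (frame_iso phi); split; first exact: frame_isoP.
exists (assoc_module P phi); split.
- move=> i x Ux u v; exact: assoc_module_addE.
- move=> i x Ux a u; exact: assoc_module_scaleE.
- exact: assoc_module_locally_free.
Qed.
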